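(* Let $k$ be a field, $a,b\ge 2$ integers, $q\in k$ a nonzero element which is not a root of unity, and $A = k\langle X,Y\rangle/(X^a,\,XY-qYX,\,Y^b)$. Then the Hochschild homology of $A$ is given by $$\dim_k \mathrm{HH}_n(A)=\begin{cases} a+b-1 & \text{when } n=0,\\ a+b & \text{when } n\ge 1 \text{ and } \operatorname{char} k \text{ divides both } a \text{ and } b,\\ a+b-1 & \text{when } n\ge 1 \text{ and } \operatorname{char} k \text{ divides exactly one of } a \text{ and } b,\\ a+b-2 & \text{when } n\ge 1 \text{ and } \operatorname{char} k \text{ divides neither } a \text{ nor } b.\end{cases}$$
   Context: For a finite dimensional $k$-algebra $A$ with enveloping algebra $A^{e}=A\otimes_k A^{op}$, the Hochschild homology is $\mathrm{HH}_n(A)=\operatorname{Tor}^{A^{e}}_n(A,A)$. *)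

(* Defs.v *)
From HB Require Import structures.
From mathcomp Require Import all_boot all_algebra all_field.
From mathcomp Require Import boolp classical_sets.
From mathcomp Require Import xfinmap monalg.

Set Implicit Arguments.
Unset Strict Implicit.
Unset Printing Implicit Defensive.

Import GRing.Theory.
Local Open Scope ring_scope.
Local Open Scope quotient_scope.

Section GeneratedSubmodule.
Context (k : nzRingType) (V : lmodType k) (S : V -> Prop).

Inductive span : V -> Prop :=
| span_gen v : S v -> span v
| span_zero : span 0
| span_comb c u v : span u -> span v -> span (c *: u + v).

Definition spanb : {pred V} := fun v => `[< span v >].

Lemma spanbP v : reflect (span v) (v \in spanb).
Proof. exact: asboolP. Qed.

Lemma spanb_submod_closed : submod_closed spanb.
Proof.
split; first by apply/spanbP; exact: span_zero.
by move=> c u v /spanbP su /spanbP sv; apply/spanbP; exact: span_comb.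
Qed.

HB.instance Definition _ := GRing.isSubmodClosed.Build k V spanb
  spanb_submod_closed.

Definition qmod : Type := Quotient.quot spanb.
HB.instance Definition _ := Choice.on qmod.

End GeneratedSubmodule.

(* The quotient map, a section of it and the module operations of qmod are
   locked to keep unification from unfolding the quotient. *)
HB.lock Definition qpi (k : nzRingType) (V : lmodType k) (S : V -> Prop)
  (v : V) : qmod S := \pi_(Quotient.quot (spanb S)) v.

HB.lock Definition qrepr (k : nzRingType) (V : lmodType k) (S : V -> Prop)
  (x : qmod S) : V := repr (x : Quotient.quot (spanb S)).

HB.lock Definition qadd (k : nzRingType) (V : lmodType k) (S : V -> Prop)
  (x y : qmod S) : qmod S := qpi S (qrepr x + qrepr y).

HB.lock Definition qopp (k : nzRingType) (V : lmodType k) (S : V -> Prop)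
  (x : qmod S) : qmod S := qpi S (- qrepr x).

HB.lock Definition qscale (k : nzRingType) (V : lmodType k) (S : V -> Prop)
  (c : k) (x : qmod S) : qmod S := qpi S (c *: qrepr x).

Section QuotientModule.
Context (k : nzRingType) (V : lmodType k) (S : V -> Prop).
Local Notation span := (span S).
Local Notation qmod := (qmod S).
Local Notation qpi := (qpi S).
Local Notation qrepr := (@qrepr k V S).
Local Notation qadd := (@qadd k V S).
Local Notation qopp := (@qopp k V S).
Local Notation qscale := (@qscale k V S).

Lemma qreprK x : qpi (qrepr x) = x.
Proof. by rewrite qpi.unlock qrepr.unlock; exact: reprK. Qed.

Lemma qpi_eq u v : qpi u = qpi v <-> span (u - v).
Proof.
rewrite qpi.unlock; split=> [e|s]; last first.
  by apply/eqP; rewrite -Quotient.idealrBE; apply/spanbP.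
by apply/spanbP; rewrite Quotient.idealrBE; apply/eqP.
Qed.

Lemma span_repr v : span (qrepr (qpi v) - v).
Proof. by apply/qpi_eq; rewrite qreprK. Qed.

Lemma qaddE u v : qadd (qpi u) (qpi v) = qpi (u + v).
Proof.
rewrite qadd.unlock; apply/qpi_eq; rewrite opprD addrACA -[_ - u]scale1r.
by apply: span_comb; apply: span_repr.
Qed.

Lemma qoppE u : qopp (qpi u) = qpi (- u).
Proof.
rewrite qopp.unlock; apply/qpi_eq; rewrite -opprD.
rewrite -[- (_ + _)]scaleN1r -[_ *: _]addr0.
by apply: span_comb; [exact: span_repr | exact: span_zero].
Qed.

Fact qaddA : associative qadd.
Proof.
by move=> x y z; rewrite -(qreprK x) -(qreprK y) -(qreprK z) !qaddE addrA.
Qed.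
Fact qaddC : commutative qadd.
Proof. by move=> x y; rewrite qadd.unlock addrC. Qed.
Fact qadd0 : left_id (qpi 0) qadd.
Proof. by move=> x; rewrite -(qreprK x) qaddE add0r. Qed.
Fact qaddN : left_inverse (qpi 0) qopp qadd.
Proof. by move=> x; rewrite -(qreprK x) qoppE qaddE addNr. Qed.

HB.instance Definition _ := GRing.isZmodule.Build qmod qaddA qaddC qadd0 qaddN.

Lemma qpi_zmod : zmod_morphism qpi.
Proof. by move=> u v; rewrite -qaddE -qoppE. Qed.

HB.instance Definition _ := GRing.isZmodMorphism.Build V qmod qpi qpi_zmod.

Lemma qpi_eq0 u : qpi u = 0 <-> span u.
Proof. by rewrite -(raddf0 qpi) qpi_eq subr0. Qed.

Lemma qpi_gen v : S v -> qpi v = 0.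
Proof. by move=> Sv; apply/qpi_eq0/span_gen. Qed.

Lemma qscaleE c v : qscale c (qpi v) = qpi (c *: v).
Proof.
rewrite qscale.unlock; apply/qpi_eq; rewrite -scalerBr -[_ *: _]addr0.
by apply: span_comb; [exact: span_repr | exact: span_zero].
Qed.

Fact qscaleA c d x : qscale c (qscale d x) = qscale (c * d) x.
Proof. by rewrite -(qreprK x) !qscaleE scalerA. Qed.
Fact qscale1 : left_id 1 qscale.
Proof. by move=> x; rewrite -(qreprK x) qscaleE scale1r. Qed.
Fact qscaleDr : right_distributive qscale +%R.
Proof.
move=> c x y; rewrite -(qreprK x) -(qreprK y).
by rewrite -raddfD !qscaleE scalerDr raddfD.
Qed.
Fact qscaleDl x : {morph qscale^~ x : c d / c + d}.
Proof. by move=> c d; rewrite -(qreprK x) !qscaleE scalerDl raddfD. Qed.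

HB.instance Definition _ := GRing.Zmodule_isLmodule.Build k qmod
  qscaleA qscale1 qscaleDr qscaleDl.

Fact qpi_scalable : scalable qpi.
Proof. by move=> c v; rewrite -qscaleE. Qed.
HB.instance Definition _ := GRing.isScalable.Build k V qmod *:%R qpi
  qpi_scalable.

Lemma qlift_pi (U : lmodType k) (g : {linear V -> U}) :
  (forall v, S v -> g v = 0) -> forall v, g (qrepr (qpi v)) = g v.
Proof.
move=> g0 v; apply/eqP; rewrite -subr_eq0 -linearB; apply/eqP.
elim: (span_repr v) => [w /g0 //||c u w _ gu _ gw]; first exact: linear0.
by rewrite linearP gu gw scaler0 addr0.
Qed.

Lemma qlift_linear (U : lmodType k) (g : {linear V -> U}) :
  (forall v, S v -> g v = 0) -> linear (fun x => g (qrepr x)).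
Proof.
move=> g0 c x y; rewrite -(qreprK x) -(qreprK y) -linearP.
by rewrite !(qlift_pi g0) linearP.
Qed.

End QuotientModule.

Section FreeLift.
Context (k : nzRingType) (K : choiceType) (U : lmodType k) (f : K -> U).

Definition free_lift (u : {malg k[K]}) : U :=
  \sum_(x <- msupp u) u@_x *: f x.

Lemma free_liftEw (D : {fset K}) u : {subset msupp u <= D} ->
  free_lift u = \sum_(x <- D) u@_x *: f x.
Proof.
move=> sD; rewrite /free_lift; apply: big_fset_incl; first exact/fsubsetP.
by move=> x _ xn; rewrite mcoeff_outdom // scale0r.
Qed.

Lemma free_liftU x : free_lift << x >> = f x.
Proof.
rewrite (free_liftEw (D := [fset x]%fset)); last exact/fsubsetP/msuppU_le.
by rewrite big_seq_fset1 mcoeffU eqxx scale1r.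
Qed.

Lemma free_lift_linear : linear free_lift.
Proof.
move=> c u v.
pose D := (msupp u `|` msupp v `|` msupp (c *: u + v))%fset.
rewrite !(free_liftEw (D := D)); try by move=> x xi; rewrite !inE xi ?orbT.
rewrite scaler_sumr -big_split /=; apply: eq_bigr => x _.
by rewrite mcoeffD mcoeffZ scalerDl scalerA.
Qed.

HB.instance Definition _ := GRing.isLinear.Build k {malg k[K]} U *:%R
  free_lift free_lift_linear.

End FreeLift.

Section TensorProduct.
Context (k : comNzRingType) (M N : lmodType k).

Inductive tens_rel : {malg k[(M * N)%type]} -> Prop :=
| tens_relDl m m' n :
    tens_rel (<< (m + m', n) >> - << (m, n) >> - << (m', n) >>)
| tens_relDr m n n' :
    tens_rel (<< (m, n + n') >> - << (m, n) >> - << (m, n') >>)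
| tens_relZl c m n : tens_rel (<< (c *: m, n) >> - c *: << (m, n) >>)
| tens_relZr c m n : tens_rel (<< (m, c *: n) >> - c *: << (m, n) >>).

Definition tens : Type := qmod tens_rel.
HB.instance Definition _ := GRing.Lmodule.on tens.

End TensorProduct.

HB.lock Definition otimes (k : comNzRingType) (M N : lmodType k) (m : M)
  (n : N) : tens M N := qpi (@tens_rel k M N) << (m, n) >>.

(* The map induced by a bilinear f (a junk value if f is not bilinear). *)
HB.lock Definition tens_lift (k : comNzRingType) (M N U : lmodType k)
  (f : M -> N -> U) (u : tens M N) : U :=
  free_lift (fun mn => f mn.1 mn.2) (qrepr u).

Section TensorTheory.
Context (k : comNzRingType) (M N : lmodType k).
Local Notation tens := (tens M N).
Local Notation tens_rel := (@tens_rel k M N).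
Local Notation otimes := (@otimes k M N).

Lemma otimesDl m m' n : otimes (m + m') n = otimes m n + otimes m' n.
Proof.
have := qpi_gen (tens_relDl m m' n); rewrite !linearB => /eqP.
by rewrite otimes.unlock -addrA -opprD subr_eq0 => /eqP.
Qed.

Lemma otimesDr m n n' : otimes m (n + n') = otimes m n + otimes m n'.
Proof.
have := qpi_gen (tens_relDr m n n'); rewrite !linearB => /eqP.
by rewrite otimes.unlock -addrA -opprD subr_eq0 => /eqP.
Qed.

Lemma otimesZl c m n : otimes (c *: m) n = c *: otimes m n.
Proof.
have := qpi_gen (tens_relZl c m n); rewrite linearB linearZ => /eqP.
by rewrite otimes.unlock subr_eq0 => /eqP.
Qed.

Lemma otimesZr c m n : otimes m (c *: n) = c *: otimes m n.
Proof.
have := qpi_gen (tens_relZr c m n); rewrite linearB linearZ => /eqP.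
by rewrite otimes.unlock subr_eq0 => /eqP.
Qed.

Lemma tens_ind (P : tens -> Prop) :
  (forall m n, P (otimes m n)) ->
  (forall c u v, P u -> P v -> P (c *: u + v)) -> forall u, P u.
Proof.
move=> PU PD u.
have P0 : P 0.
  by rewrite -(addNr (otimes 0 0)) -scaleN1r; apply: (PD); apply: PU.
rewrite -(qreprK u); set w := qrepr u.
rewrite (monalgE w) linear_sum /=; apply: big_ind => //.
  by move=> x y Px Py; rewrite -[x]scale1r; exact: PD.
move=> [m n] _; have -> : << w@_(m, n) *g (m, n) >> = w@_(m, n) *: << (m, n) >>.
  by apply/malgP=> x; rewrite mcoeffZ !mcoeffU mulrnAr mulr1.
rewrite linearZ /= -[_ *: _]addr0; apply: PD => //.
by have := PU m n; rewrite otimes.unlock.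
Qed.

Definition bilin (U : lmodType k) (f : M -> N -> U) : Prop :=
  (forall n, linear (f^~ n)) /\ (forall m, linear (f m)).

Section Lift.
Context (U : lmodType k) (f : M -> N -> U).
Hypothesis fb : bilin f.

Lemma tens_lift_rel v : tens_rel v -> free_lift (fun mn => f mn.1 mn.2) v = 0.
Proof.
case: fb => fl fr; case=> [m m' n|m n n'|c m n|c m n].
- rewrite !linearB /= !free_liftU /=.
  by have := fl n 1 m m'; rewrite !scale1r => ->; rewrite addrAC addrK subrr.
- rewrite !linearB /= !free_liftU /=.
  by have := fr m 1 n n'; rewrite !scale1r => ->; rewrite addrAC addrK subrr.
- rewrite linearB linearZ /= !free_liftU /=.
  have f0 : f 0 n = 0.
    by have := fl n (-1) 0 0; rewrite scaler0 addr0 scaleN1r addNr.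
  by have := fl n c m 0; rewrite f0 !addr0 => ->; rewrite subrr.
rewrite linearB linearZ /= !free_liftU /=.
have f0 : f m 0 = 0.
  by have := fr m (-1) 0 0; rewrite scaler0 addr0 scaleN1r addNr.
by have := fr m c n 0; rewrite f0 !addr0 => ->; rewrite subrr.
Qed.

Lemma tens_liftE m n : tens_lift f (otimes m n) = f m n.
Proof.
by rewrite tens_lift.unlock otimes.unlock (qlift_pi tens_lift_rel) /= free_liftU.
Qed.

Lemma tens_lift_linear : linear (tens_lift f).
Proof. by rewrite tens_lift.unlock; exact: qlift_linear tens_lift_rel. Qed.

End Lift.
End TensorTheory.

Section TensorMap.
Context (k : comNzRingType) (M N N' : lmodType k) (f : {linear N -> N'}).

Definition tens_map : tens M N -> tens M N' :=
  tens_lift (fun m n => otimes m (f n)).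

Lemma tens_map_bilin : bilin (fun (m : M) n => otimes m (f n)).
Proof.
split=> [n c m m'|m c n n'] /=; first by rewrite otimesDl otimesZl.
by rewrite linearP otimesDr otimesZr.
Qed.

Lemma tens_mapE m n : tens_map (otimes m n) = otimes m (f n).
Proof. exact: tens_liftE tens_map_bilin m n. Qed.

Lemma tens_map_linear : linear tens_map.
Proof. exact: tens_lift_linear tens_map_bilin. Qed.

HB.instance Definition _ := GRing.isLinear.Build k (tens M N) (tens M N') *:%R
  tens_map tens_map_linear.

End TensorMap.

(* MathComp equips A^c with the opposite product but not with scalars. *)
Section ConverseAlgebra.
Context (k : comNzRingType) (A : algType k).

HB.instance Definition _ := GRing.Zmodule_isLmodule.Build k A^c
  (@scalerA k A) (@scale1r k A) (@scalerDr k A) (@scalerDl k A).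

Fact converse_scaleAl (c : k) (x y : A^c) : c *: (x * y) = (c *: x : A^c) * y.
Proof. exact: (scalerAr c (y : A) (x : A)). Qed.
HB.instance Definition _ := GRing.Lmodule_isLalgebra.Build k A^c
  converse_scaleAl.

Fact converse_scaleAr (c : k) (x y : A^c) : c *: (x * y) = x * (c *: y : A^c).
Proof. exact: (scalerAl c (y : A) (x : A)). Qed.
HB.instance Definition _ := GRing.Lalgebra_isAlgebra.Build k A^c
  converse_scaleAr.

End ConverseAlgebra.

Section TensorAlgebra.
(* A is finite dimensional so that 1 \otimes 1 != 0 follows without choosing a
   basis of an infinite dimensional space; algType excludes the zero ring. *)
Context (k : fieldType) (A : falgType k) (B : algType k).
Local Notation "a \ox b" := (@otimes k A B a b) (at level 40).

Definition tmul_pure (a : A) (b : B) : tens A B -> tens A B :=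
  tens_lift (fun a' b' => (a * a') \ox (b * b')).

Definition tmul (u v : tens A B) : tens A B :=
  tens_lift (fun a b => tmul_pure a b v) u.

Fact tmul_pure_bilin a b : bilin (fun a' b' => (a * a') \ox (b * b')).
Proof.
split=> [b' c x y|a' c x y] /=.
  by rewrite mulrDr -scalerAr otimesDl otimesZl.
by rewrite mulrDr -scalerAr otimesDr otimesZr.
Qed.

Fact tmul_pureE a b a' b' :
  tmul_pure a b (a' \ox b') = (a * a') \ox (b * b').
Proof. exact: (tens_liftE (tmul_pure_bilin a b)). Qed.

Fact tmul_pure_linear a b : linear (tmul_pure a b).
Proof. exact: (tens_lift_linear (tmul_pure_bilin a b)). Qed.

Opaque tmul_pure.

Fact tmul_bilin v : bilin (fun a b => tmul_pure a b v).
Proof.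
split=> [b c x y|a c x y] /=; elim/tens_ind: v => [a' b'|d u v IHu IHv].
- by rewrite !tmul_pureE mulrDl -scalerAl otimesDl otimesZl.
- rewrite !tmul_pure_linear IHu IHv.
  by rewrite !scalerDr !scalerA [d * c]mulrC addrACA.
- by rewrite !tmul_pureE mulrDl -scalerAl otimesDr otimesZr.
rewrite !tmul_pure_linear IHu IHv.
by rewrite !scalerDr !scalerA [d * c]mulrC addrACA.
Qed.

Fact tmul_purel a b v : tmul (a \ox b) v = tmul_pure a b v.
Proof. exact: (tens_liftE (tmul_bilin v)). Qed.

Fact tmulE a b a' b' :
  tmul (a \ox b) (a' \ox b') = (a * a') \ox (b * b').
Proof. by rewrite tmul_purel tmul_pureE. Qed.

Fact tmul_linl v : linear (tmul^~ v).
Proof. exact: (tens_lift_linear (tmul_bilin v)). Qed.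

Fact tmul_linr u : linear (tmul u).
Proof.
move=> c v w; elim/tens_ind: u => [a b|d u u' IHu IHu'].
  by rewrite !tmul_purel tmul_pure_linear.
rewrite !tmul_linl IHu IHu'.
by rewrite !scalerDr !scalerA [d * c]mulrC addrACA.
Qed.

Opaque tmul.

Definition tone : tens A B := 1 \ox 1.

Fact tmulA : associative tmul.
Proof.
move=> u v w; elim/tens_ind: u => [a b|c u u' IHu IHu']; last first.
  by rewrite !tmul_linl IHu IHu'.
elim/tens_ind: v => [a' b'|c v v' IHv IHv']; last first.
  by rewrite tmul_linl !tmul_linr tmul_linl IHv IHv'.
elim/tens_ind: w => [a'' b''|c w w' IHw IHw']; last first.
  by rewrite !tmul_linr IHw IHw'.
by rewrite !tmulE !mulrA.
Qed.

Fact tmul1l : left_id tone tmul.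
Proof.
move=> u; elim/tens_ind: u => [a b|c u u' IHu IHu'].
  by rewrite tmulE !mul1r.
by rewrite tmul_linr IHu IHu'.
Qed.

Fact tmul1r : right_id tone tmul.
Proof.
move=> u; elim/tens_ind: u => [a b|c u u' IHu IHu'].
  by rewrite tmulE !mulr1.
by rewrite tmul_linl IHu IHu'.
Qed.

Fact tmulDl : left_distributive tmul +%R.
Proof. by move=> u v w; have := tmul_linl w 1 u v; rewrite !scale1r. Qed.

Fact tmulDr : right_distributive tmul +%R.
Proof. by move=> u v w; have := tmul_linr u 1 v w; rewrite !scale1r. Qed.

Fact tone_neq0 : tone != 0.
Proof.
pose f (a : A) (b : B) : B := coord [tuple of [:: 1 : A]] ord0 a *: b.
have fb : bilin f.
  split=> [b c x y|a c x y]; rewrite /f; first by rewrite linearP scalerDl scalerA.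
  by rewrite scalerDr !scalerA mulrC.
apply/eqP=> e; have := tens_liftE fb 1 1; rewrite -/tone e.
have f0 : tens_lift f 0 = 0.
  by have := tens_lift_linear fb (-1) 0 0; rewrite scaler0 addr0 scaleN1r addNr.
have -> : f 1 1 = 1.
  have fr : free [tuple of [:: 1 : A]] by rewrite seq1_free oner_eq0.
  have := coord_free ord0 ord0 fr; rewrite /f /= => ->.
  by rewrite scale1r.
by rewrite f0 => /eqP; rewrite eq_sym oner_eq0.
Qed.

Definition talg : Type := tens A B.
HB.instance Definition _ := GRing.Lmodule.on talg.

HB.instance Definition _ := GRing.Zmodule_isNzRing.Build talg
  tmulA tmul1l tmul1r tmulDl tmulDr tone_neq0.

Fact tscaleAl (c : k) (u v : talg) : c *: (u * v) = (c *: u) * v.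
Proof.
have t0 : tmul 0 v = 0.
  by have := tmul_linl v (-1) 0 0; rewrite scaler0 addr0 scaleN1r addNr.
by have := tmul_linl v c u 0; rewrite t0 !addr0.
Qed.
HB.instance Definition _ := GRing.Lmodule_isLalgebra.Build k talg tscaleAl.

Fact tscaleAr (c : k) (u v : talg) : c *: (u * v) = u * (c *: v).
Proof.
have t0 : tmul u 0 = 0.
  by have := tmul_linr u (-1) 0 0; rewrite scaler0 addr0 scaleN1r addNr.
by have := tmul_linr u c v 0; rewrite t0 !addr0.
Qed.
HB.instance Definition _ := GRing.Lalgebra_isAlgebra.Build k talg tscaleAr.

Lemma talg_mulE a b a' b' :
  (a \ox b : talg) * (a' \ox b' : talg) = (a * a') \ox (b * b').
Proof. exact: tmulE. Qed.

End TensorAlgebra.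

Section RestrictionOfScalars.
Context (k : comNzRingType) (R : algType k) (V : lmodType R).

Definition restr : Type := V.
HB.instance Definition _ := GRing.Zmodule.on restr.

Definition restr_scale (c : k) (v : restr) : restr := (c%:A : R) *: (v : V).

Fact restr_scaleA c d v : restr_scale c (restr_scale d v) = restr_scale (c * d) v.
Proof. by rewrite /restr_scale scalerA -scalerAl mul1r scalerA. Qed.
Fact restr_scale1 : left_id 1 restr_scale.
Proof. by move=> v; rewrite /restr_scale !scale1r. Qed.
Fact restr_scaleDr : right_distributive restr_scale +%R.
Proof. by move=> c u v; rewrite /restr_scale scalerDr. Qed.
Fact restr_scaleDl v : {morph restr_scale^~ v : c d / c + d}.
Proof. by move=> c d; rewrite /restr_scale !scalerDl. Qed.

HB.instance Definition _ := GRing.Zmodule_isLmodule.Build k restr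
  restr_scaleA restr_scale1 restr_scaleDr restr_scaleDl.

End RestrictionOfScalars.

Section RestrictedMap.
Context (k : comNzRingType) (R : algType k) (V W : lmodType R).
Context (f : {linear V -> W}).

Definition restr_map (v : restr V) : restr W := f v.

Fact restr_map_linear : linear restr_map.
Proof. by move=> c u v; exact: linearP. Qed.

HB.instance Definition _ := GRing.isLinear.Build k (restr V) (restr W) *:%R
  restr_map restr_map_linear.

End RestrictedMap.

(* M \otimes_R N for a right R-module M (a module over the converse ring R^c)
   and a left R-module N: the quotient of M \otimes_k N by the submodule
   spanned by the elements m r \otimes n - m \otimes r n. *)
Section TensorOver.
Context (k : comNzRingType) (R : algType k).
Context (M : lmodType R^c) (N : lmodType R).

Inductive balanced_rel : tens (@restr k R^c M) (@restr k R N) -> Prop :=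
| balanced_rel_intro (r : R) (m : M) (n : N) :
    balanced_rel (otimes (((r : R^c) *: m : M) : restr M) (n : restr N)
                - otimes (m : restr M) ((r *: n : N) : restr N)).

Definition tens_over : Type := qmod balanced_rel.
HB.instance Definition _ := GRing.Lmodule.on tens_over.

End TensorOver.

Section TensorOverMap.
Context (k : comNzRingType) (R : algType k) (M : lmodType R^c).
Context (N N' : lmodType R) (f : {linear N -> N'}).

Local Notation idf := (tens_map (M := @restr k R^c M) (restr_map (k := k) f)).

Definition tens_over_map (u : @tens_over k R M N) : @tens_over k R M N' :=
  qpi (@balanced_rel k R M N') (idf (qrepr u)).

Fact tens_over_map_rel v : @balanced_rel k R M N v ->
  qpi (@balanced_rel k R M N') (idf v) = 0.
Proof.
case=> r m n; rewrite linearB /= !tens_mapE.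
have fZ : f (r *: n) = r *: f n by exact: linearZ.
by have := qpi_gen (@balanced_rel_intro k R M N' r m (f n)); rewrite -fZ.
Qed.

Fact tens_over_map_linear : linear tens_over_map.
Proof.
exact: (qlift_linear (g := qpi (@balanced_rel k R M N') \o idf) tens_over_map_rel).
Qed.

HB.instance Definition _ := GRing.isLinear.Build k
  (tens_over M N) (tens_over M N') *:%R tens_over_map tens_over_map_linear.

End TensorOverMap.

Section Homology.
Context (k : nzRingType) (T : nat -> lmodType k).
Context (d : forall n, {linear T n.+1 -> T n}).

(* The differential leaving degree 0 is zero. *)
Definition cycle n : {pred T n} :=
  match n return T n -> bool with
  | 0 => fun=> true
  | m.+1 => fun x => d m x == 0
  end.

Fact cycle_submod_closed n : submod_closed (@cycle n).
Proof.
case: n => [|n]; split=> //; first by rewrite unfold_in /= linear0.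
move=> c u v; rewrite !unfold_in /= => /eqP du /eqP dv.
by rewrite linearP du dv scaler0 addr0.
Qed.

HB.instance Definition _ n := GRing.isSubmodClosed.Build k (T n) (@cycle n)
  (@cycle_submod_closed n).

Record cycles n : Type := Cycles { cycles_val : T n; _ : cycles_val \in @cycle n }.

HB.instance Definition _ n := [isSub for @cycles_val n].
HB.instance Definition _ n := [Choice of cycles n by <:].
HB.instance Definition _ n := [SubChoice_isSubLmodule of cycles n by <:].

Definition boundary n (z : cycles n) : Prop := exists y, d n y = val z.

Definition homology n : Type := qmod (@boundary n).
HB.instance Definition _ n := GRing.Lmodule.on (homology n).

End Homology.

Definition has_dim (k : nzRingType) (V : lmodType k) (d : nat) : Prop :=
  exists f : {linear 'rV[k]_d -> V}, bijective f.

Definition projective (R : nzRingType) (P : lmodType R) : Prop :=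
  forall (U V : lmodType R) (g : {linear U -> V}) (f : {linear P -> V}),
    (forall v, exists u, g u = v) ->
    exists h : {linear P -> U}, forall p, g (h p) = f p.

Record proj_resolution (R : nzRingType) (N : lmodType R) := ProjResolution {
  res_obj : nat -> lmodType R;
  res_diff : forall n, {linear res_obj n.+1 -> res_obj n};
  res_aug : {linear res_obj 0 -> N};
  res_projective : forall n, projective (res_obj n);
  res_aug_surj : forall x, exists p, res_aug p = x;
  res_exact0 : forall p, res_aug p = 0 <-> exists p', res_diff 0 p' = p;
  res_exactS : forall n p,
    res_diff n p = 0 <-> exists p', res_diff n.+1 p' = p
}.

Definition tor (k : comNzRingType) (R : algType k) (M : lmodType R^c)
    (N : lmodType R) (P : proj_resolution N) (n : nat) : lmodType k :=
  homology (fun i => @tens_over_map k R M _ _ (res_diff P i)) n.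

(* dim_k Tor_n^R(M, N) = d: some projective resolution of N exists, and all of
   them give n-th homology of dimension d after applying M \otimes_R -. *)
Definition tor_dim (k : comNzRingType) (R : algType k) (M : lmodType R^c)
    (N : lmodType R) (n d : nat) : Prop :=
  inhabited (proj_resolution N) /\
  forall P : proj_resolution N, has_dim (@tor k R M N P n) d.

Section Enveloping.
Context (k : fieldType) (A : falgType k).

Definition envalg : algType k := talg A A^c.

(* (a \otimes b) x = a x b *)
Definition env_lact (u : envalg) (x : A) : A :=
  tens_lift (fun (a : A) (b : A^c) => a * x * (b : A)) u.

(* x (a \otimes b) = b x a *)
Definition env_ract (u : envalg) (x : A) : A :=
  tens_lift (fun (a : A) (b : A^c) => (b : A) * x * a) u.

Fact env_lact_bilin x : bilin (fun (a : A) (b : A^c) => a * x * (b : A) : A).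
Proof.
split=> [b c u v|a c u v] /=; first by rewrite !mulrDl -!scalerAl.
by rewrite mulrDr; congr (_ + _); exact: (esym (scalerAr c (a * x) (u : A))).
Qed.

Fact env_ract_bilin x : bilin (fun (a : A) (b : A^c) => (b : A) * x * a : A).
Proof.
split=> [b c u v|a c u v] /=; first by rewrite mulrDr -scalerAr.
rewrite 2!mulrDl; congr (_ + _).
by rewrite [RHS]scalerAl; congr (_ * _); exact: (esym (scalerAl c (u : A) x)).
Qed.

Fact env_lactE (a b x : A) : env_lact (otimes a (b : A^c)) x = a * x * b.
Proof. exact: (tens_liftE (env_lact_bilin x)). Qed.

Fact env_ractE (a b x : A) : env_ract (otimes a (b : A^c)) x = b * x * a.
Proof. exact: (tens_liftE (env_ract_bilin x)). Qed.

Fact env_lact_linear x : linear (env_lact^~ x).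
Proof. exact: (tens_lift_linear (env_lact_bilin x)). Qed.

Fact env_ract_linear x : linear (env_ract^~ x).
Proof. exact: (tens_lift_linear (env_ract_bilin x)). Qed.

(* A as a left, resp. right, module over its enveloping algebra *)
Definition left_env : Type := A.
HB.instance Definition _ := GRing.Zmodule.on left_env.

Definition right_env : Type := A.
HB.instance Definition _ := GRing.Zmodule.on right_env.

Fact env_lactA (u v : envalg) x : env_lact u (env_lact v x) = env_lact (u * v) x.
Proof.
elim/tens_ind: u => [a b|c u u' IHu IHu']; last first.
  rewrite mulrDl -scalerAl !env_lact_linear.
  by rewrite IHu IHu'.
elim/tens_ind: v => [a' b'|c v v' IHv IHv']; last first.
  rewrite mulrDr -scalerAr !env_lact_linear -IHv -IHv' !env_lactE.
  by rewrite mulrDr mulrDl -scalerAr -scalerAl.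
by rewrite talg_mulE !env_lactE !mulrA.
Qed.

Fact env_lact1 : left_id 1 env_lact.
Proof. by move=> x; rewrite env_lactE mul1r mulr1. Qed.

Fact env_lactDr : right_distributive env_lact +%R.
Proof.
move=> u x y; elim/tens_ind: u => [a b|c u v IHu IHv].
  by rewrite !env_lactE mulrDr mulrDl.
by rewrite !env_lact_linear IHu IHv scalerDr addrACA.
Qed.

Fact env_lactDl x : {morph env_lact^~ x : u v / u + v}.
Proof. by move=> u v; have := env_lact_linear x 1 u v; rewrite !scale1r. Qed.

HB.instance Definition _ := GRing.Zmodule_isLmodule.Build envalg left_env
  env_lactA env_lact1 env_lactDr env_lactDl.

Fact env_ractA (u v : envalg^c) x : env_ract u (env_ract v x) = env_ract (u * v) x.
Proof.
change (env_ract u (env_ract v x) = env_ract ((v : envalg) * (u : envalg)) x).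
elim/tens_ind: u => [a b|c u u' IHu IHu']; last first.
  rewrite mulrDr -scalerAr !env_ract_linear.
  by rewrite IHu IHu'.
elim/tens_ind: v => [a' b'|c v v' IHv IHv']; last first.
  rewrite mulrDl -scalerAl !env_ract_linear -IHv -IHv' !env_ractE.
  by rewrite mulrDr mulrDl -scalerAr -scalerAl.
by rewrite talg_mulE !env_ractE !mulrA.
Qed.

Fact env_ract1 : left_id (1 : envalg^c) env_ract.
Proof. by move=> x; rewrite env_ractE mul1r mulr1. Qed.

Fact env_ractDr : right_distributive env_ract +%R.
Proof.
move=> u x y; elim/tens_ind: u => [a b|c u v IHu IHv].
  by rewrite !env_ractE mulrDr mulrDl.
by rewrite !env_ract_linear IHu IHv scalerDr addrACA.
Qed.

Fact env_ractDl x : {morph env_ract^~ x : u v / u + v}.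
Proof. by move=> u v; have := env_ract_linear x 1 u v; rewrite !scale1r. Qed.

HB.instance Definition _ := GRing.Zmodule_isLmodule.Build envalg^c right_env
  env_ractA env_ract1 env_ractDr env_ractDl.

End Enveloping.

(* dim_k HH_n(A) = d. *)
Definition hochschild_dim (k : fieldType) (A : falgType k) (n d : nat) : Prop :=
  @tor_dim k (envalg A) (right_env A) (left_env A) n d.

Inductive two_sided_ideal (F : nzRingType) (S : F -> Prop) : F -> Prop :=
| two_sided_ideal_gen x s y : S s -> two_sided_ideal S (x * s * y)
| two_sided_ideal0 : two_sided_ideal S 0
| two_sided_idealD u v : two_sided_ideal S u -> two_sided_ideal S v ->
    two_sided_ideal S (u + v).

(* pi exhibits A as the quotient of F by the two-sided ideal generated by S. *)
Definition is_quotient (k : nzRingType) (F A : lalgType k)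
    (pi : {lrmorphism F -> A}) (S : F -> Prop) : Prop :=
  (forall x, exists u, pi u = x) /\
  (forall u, pi u = 0 <-> two_sided_ideal S u).

Section QuantumCompleteIntersection.
Context (k : fieldType).

Definition free_alg2 : lalgType k := {malg k[{fmonom 'I_2}]}.

Definition Xgen : free_alg2 := << fmu (ord0 : 'I_2) >>.
Definition Ygen : free_alg2 := << fmu (ord_max : 'I_2) >>.

Definition qci_rel (q : k) (a b : nat) (u : free_alg2) : Prop :=
  [\/ u = Xgen ^+ a, u = Xgen * Ygen - q *: (Ygen * Xgen) | u = Ygen ^+ b].

End QuantumCompleteIntersection.

(* [pchar k] has at most one element, and none exactly in characteristic 0. *)
Definition characteristic (k : fieldType) : nat :=
  xget 0%N [set p | p \in [pchar k]]%classic.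

(* Main.v *)
(* The bimodule resolution of A is a q-twisted tensor product of the 2-periodic
   resolutions of k[x]/(x^a) and k[y]/(y^b).  Its terms are free over A^e on
   generators e_(r,s), and the basis (x^i e_r x^k)(y^j e_s y^l) turns it into an
   honest tensor product of complexes, so that a contracting homotopy in each
   variable contracts it.  After applying A (x)_(A^e) -, everything is bigraded
   by the total exponents (u, v) of x and y, and in x-degree u > 0 the x-complex
   becomes k -> k with differential 1 - q^v or 1 + q^v + ... + q^(v(a-1)).
   As q is not a root of unity this is invertible when v > 0.  Hence only the
   bidegrees (u, 0) and (0, v) survive, where one finds the Hochschild homology
   of k[x]/(x^a) and k[y]/(y^b), in which the differentials are 0, a and b. *)
Require Import Defs.
From HB Require Import structures.
From mathcomp Require Import all_boot all_algebra all_field.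
From mathcomp Require Import boolp xfinmap monalg ring zify.

Set Implicit Arguments.
Unset Strict Implicit.
Unset Printing Implicit Defensive.

Import GRing.Theory.
Local Open Scope ring_scope.
Local Notation cycle d n := (@Defs.cycle _ _ d n).

(** * Comparison of projective resolutions *)

(** [hochschild_dim] quantifies over all projective resolutions, so an explicit one helps only after
    the comparison theorem. The twist is removed by rescaling: in the bases [emonom] of A^e and
    [hmonom] of A each monomial carries the power of q that it costs to move it past the generators,
    and the differentials turn into one-variable formulas. Exactness of the bimodule complex and the
    homology of the Hochschild complex are then two cases of one homotopy, [tot_homotopy]. In the
    first its remainder lives in degree 0 and factors through the augmentation; in the second it is
    the projection onto explicit harmonic monomials, which are counted. These homotopies are linear
    over k only. For n >= 1 each variable contributes its exponent minus 1, plus 1 if char k divides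
    that exponent; for n = 0 the contributions a and b share the monomial 1. That the x^i y^j are
    independent in A comes from functionals on the free algebra that kill the ideal. *)

Lemma has_dim_transfer (k : nzRingType) (V W : lmodType k) d
    (f : {linear V -> W}) (g : {linear W -> V}) :
  cancel f g -> cancel g f -> has_dim V d -> has_dim W d.
Proof.
move=> fK gK [u u_bij]; exists (f \o u).
by apply: bij_comp u_bij; exists g.
Qed.

Section HomologyMap.
Context (k : nzRingType) (T T' : nat -> lmodType k).
Context (d : forall n, {linear T n.+1 -> T n}).
Context (d' : forall n, {linear T' n.+1 -> T' n}).
Context (f : forall n, {linear T n -> T' n}).
Hypothesis fd : forall n x, f n (d n x) = d' n (f n.+1 x).

Lemma chain_map_cycle n x : x \in cycle d n -> f n x \in cycle d' n.
Proof.
case: n x => // n x; rewrite !unfold_in /= => /eqP dx.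
by rewrite -fd dx linear0.
Qed.

Definition cycles_map n (z : cycles d n) : cycles d' n :=
  Cycles (chain_map_cycle (valP z)).

Lemma cycles_map_linear n : linear (@cycles_map n).
Proof. by move=> c u v; apply: val_inj; rewrite /= linearP. Qed.

HB.instance Definition _ n :=
  GRing.isLinear.Build k (cycles d n) (cycles d' n) *:%R (@cycles_map n)
    (@cycles_map_linear n).

Definition homology_map n (h : homology d n) : homology d' n :=
  qpi (@boundary k T' d' n) (cycles_map (qrepr h)).

Lemma cycles_map_boundary n z : boundary (d := @d) (n := n) z ->
  qpi (@boundary k T' d' n) (cycles_map z) = 0.
Proof. by case=> y dy; apply: qpi_gen; exists (f _ y); rewrite /= -dy fd. Qed.

Lemma homology_map_linear n : linear (@homology_map n).
Proof.
exact: (qlift_linear (g := qpi (@boundary k T' d' n) \o @cycles_map n)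
          (@cycles_map_boundary n)).
Qed.

HB.instance Definition _ n :=
  GRing.isLinear.Build k (homology d n) (homology d' n) *:%R
    (@homology_map n) (@homology_map_linear n).

Lemma homology_mapE n z : homology_map (qpi (@boundary k T d n) z)
  = qpi (@boundary k T' d' n) (cycles_map z).
Proof.
exact: (qlift_pi (g := qpi (@boundary k T' d' n) \o @cycles_map n)
          (@cycles_map_boundary n)).
Qed.

End HomologyMap.

(** The hypothesis is asked on cycles only: there the term s d of a homotopy vanishes, and what
    remains of the homotopy says that z and g (f z) differ by a boundary. *)
Lemma homology_mapK (k : nzRingType) (T T' : nat -> lmodType k)
    (d : forall n, {linear T n.+1 -> T n})
    (d' : forall n, {linear T' n.+1 -> T' n})
    (f : forall n, {linear T n -> T' n}) (g : forall n, {linear T' n -> T n})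
    (fd : forall n x, f n (d n x) = d' n (f n.+1 x))
    (gd : forall n x, g n (d' n x) = d n (g n.+1 x)) n :
  (forall z, z \in cycle d n -> exists y, d n y = z - g n (f n z)) ->
  cancel (@homology_map _ _ _ d d' f fd n) (homology_map gd (n := n)).
Proof.
move=> gf h; rewrite -(qreprK h) !homology_mapE; apply/eqP.
rewrite eq_sym -subr_eq0 -linearB; apply/eqP/qpi_gen.
by have [y dy] := gf _ (valP (qrepr h)); exists y; rewrite dy.
Qed.

Lemma homology_transfer (k : nzRingType) (T T' : nat -> lmodType k)
    (d : forall n, {linear T n.+1 -> T n})
    (d' : forall n, {linear T' n.+1 -> T' n})
    (f : forall n, {linear T n -> T' n}) (g : forall n, {linear T' n -> T n})
    (fd : forall n x, f n (d n x) = d' n (f n.+1 x))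
    (gd : forall n x, g n (d' n x) = d n (g n.+1 x)) n m :
  (forall z, z \in cycle d n -> exists y, d n y = z - g n (f n z)) ->
  (forall z, z \in cycle d' n -> exists y, d' n y = z - f n (g n z)) ->
  has_dim (homology d n) m -> has_dim (homology d' n) m.
Proof.
move=> gf fg.
exact: has_dim_transfer (homology_mapK fd gd gf) (homology_mapK gd fd fg).
Qed.

Section Comparison.
Context (R : nzRingType).
Implicit Types T U : nat -> lmodType R.

(** [projective] lifts along maps onto their whole target, so [f] and [d n] are corestricted to the
    module of cycles, onto which [d n] is surjective by exactness. *)
Lemma projective_lift_cycle (P : lmodType R) U
    (d : forall n, {linear U n.+1 -> U n}) n (f : {linear P -> U n}) :
  projective P -> (forall x, x \in cycle d n -> exists y, d n y = x) ->
  (forall n y, d n y \in cycle d n) ->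
  (forall p, f p \in cycle d n) -> exists h : {linear P -> U n.+1},
    forall p, d n (h p) = f p.
Proof.
move=> projP ex dd fc.
pose fc' p : cycles d n := Cycles (fc p).
have fl : linear fc' by move=> c u v; apply: val_inj; rewrite /= linearP.
pose d' p : cycles d n := Cycles (dd n p).
have dl : linear d' by move=> c u v; apply: val_inj; rewrite /= linearP.
pose fL := GRing.isLinear.Build R P (cycles d n) *:%R fc' fl.
pose dL := GRing.isLinear.Build R (U n.+1) (cycles d n) *:%R d' dl.
pose F : {linear P -> cycles d n} := HB.pack fc' fL.
pose D : {linear U n.+1 -> cycles d n} := HB.pack d' dL.
have [v|h hP] := projP _ _ D F.
  by have [y dy] := ex _ (valP v); exists y; apply: val_inj.
by exists h => p; have /(congr1 val) := hP p.
Qed.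

Section Lift.
Context (T U : nat -> lmodType R).
Context (d : forall n, {linear T n.+1 -> T n}).
Context (d' : forall n, {linear U n.+1 -> U n}).
Hypothesis projT : forall n, projective (T n.+1).
Hypothesis dT : forall n y, d n y \in cycle d n.
Hypothesis dU : forall n y, d' n y \in cycle d' n.
Hypothesis exU : forall n x, x \in cycle d' n -> exists y, d' n y = x.

Let dd n y : d n (d n.+1 y) = 0.
Proof. by have := dT (n := n.+1) y; rewrite unfold_in /= => /eqP. Qed.

Lemma chain_map_lift (f0 : {linear T 0 -> U 0}) :
  exists2 f : forall n, {linear T n -> U n}, f 0 = f0 &
    forall n x, f n (d n x) = d' n (f n.+1 x).
Proof.
(* The recursion carries the invariant that boundaries go to cycles; this is what allows the next
   lift. In degree 0 it is trivial, since everything is a cycle there. *)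
pose S n := {f : {linear T n -> U n} | forall y, f (d n y) \in cycle d' n}.
have step n (s : S n) :
    {s' : S n.+1 | forall x, sval s (d n x) = d' n (sval s' x)}.
  apply: cid; case: s => f fP /=.
  have [h hP] := projective_lift_cycle (f := f \o d n) (@projT n)
    (@exU n) dU fP.
  suff hS y : h (d n.+1 y) \in cycle d' n.+1 by exists (exist _ h hS).
  by rewrite unfold_in /= hP /= dd linear0.
have s0 : S 0 by exists f0.
pose F := fix F n : S n :=
  match n with 0 => exist _ f0 (fun=> isT) | m.+1 => sval (step m (F m)) end.
by exists (fun n => sval (F n)) => // n x; exact: (svalP (step n (F n))).
Qed.

(** The invariant d' s = f on boundaries gives d' (f - s d) = f d - d' s d = 0, so f - s d lands in
    cycles and lifts to the next s. *)
Lemma chain_homotopy_lift (f : forall n, {linear T n -> U n}) :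
    (forall n x, f n (d n x) = d' n (f n.+1 x)) -> (forall x, f 0 x = 0) ->
  exists2 s : forall n, {linear T n -> U n.+1}, forall x, s 0 x = 0 &
    forall n x, f n.+1 x = d' n.+1 (s n.+1 x) + s n (d n x).
Proof.
move=> fd f0.
pose S n := {s : {linear T n -> U n.+1} |
  forall y, d' n (s (d n y)) = f n (d n y)}.
have step n (s : S n) : {s' : S n.+1 |
    forall x, f n.+1 x = d' n.+1 (sval s' x) + sval s (d n x)}.
  apply: cid; case: s => s sP /=.
  have gc p : (f n.+1 \- (s \o d n)) p \in cycle d' n.+1.
    by rewrite unfold_in /= linearB /= -fd sP subrr.
  have [h hP] := projective_lift_cycle (@projT n) (@exU n.+1) dU gc.
  have hS y : d' n.+1 (h (d n.+1 y)) = f n.+1 (d n.+1 y).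
    by rewrite hP /= dd linear0 subr0.
  by exists (exist _ h hS) => x; rewrite /= hP /= subrK.
have s0P y : d' 0 ((\0%R : {linear T 0 -> U 1}) (d 0 y)) = f 0 (d 0 y).
  by rewrite f0 linear0.
pose F := fix F n : S n :=
  match n with 0 => exist _ _ s0P | m.+1 => sval (step m (F m)) end.
by exists (fun n => sval (F n)) => // n x; exact: (svalP (step n (F n))).
Qed.

End Lift.
End Comparison.

Section Augmented.
Context (R : nzRingType) (N : lmodType R) (P : proj_resolution N).

(** Placing [N] in degree 0 turns surjectivity of the augmentation and exactness in all degrees into
    the single statement [aug_exact], and lets lifts start from the identity of [N]. *)
Definition aug_obj n : lmodType R := if n is m.+1 then res_obj P m else N.

Definition aug_diff n : {linear aug_obj n.+1 -> aug_obj n} :=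
  match n return {linear aug_obj n.+1 -> aug_obj n} with
  | 0 => res_aug P
  | m.+1 => res_diff P m
  end.

Lemma aug_diff_cycle n y : aug_diff n y \in cycle aug_diff n.
Proof.
case: n y => // -[|n] y; rewrite unfold_in /=; apply/eqP.
  by apply/res_exact0; exists y.
by apply/res_exactS; exists y.
Qed.

Lemma aug_exact n x : x \in cycle aug_diff n -> exists y, aug_diff n y = x.
Proof.
case: n x => [x _|[|n] x]; first exact: res_aug_surj.
  by rewrite unfold_in /= => /eqP/res_exact0.
by rewrite unfold_in /= => /eqP/res_exactS.
Qed.

End Augmented.

Lemma resolution_map (R : nzRingType) (N : lmodType R)
    (P P' : proj_resolution N) :
  exists f : forall n, {linear aug_obj P n -> aug_obj P' n},
    (forall x, f 0 x = x) /\
    (forall n x, f n (aug_diff P n x) = aug_diff P' n (f n.+1 x)).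
Proof.
have [f f0 fd] := chain_map_lift (d := aug_diff P) (@res_projective _ _ P)
  (@aug_diff_cycle _ _ P) (@aug_diff_cycle _ _ P') (@aug_exact _ _ P')
  (idfun : {linear N -> N}).
by exists f; split=> // x; rewrite f0.
Qed.

Lemma resolution_homotopy (R : nzRingType) (N : lmodType R)
    (P P' : proj_resolution N)
    (f g : forall n, {linear aug_obj P n -> aug_obj P' n}) :
    (forall x, f 0 x = g 0 x) ->
    (forall n x, f n (aug_diff P n x) = aug_diff P' n (f n.+1 x)) ->
    (forall n x, g n (aug_diff P n x) = aug_diff P' n (g n.+1 x)) ->
  exists2 s : forall n, {linear aug_obj P n -> aug_obj P' n.+1},
    forall x, s 0 x = 0 &
    forall n x, f n.+1 x
      = g n.+1 x + (aug_diff P' n.+1 (s n.+1 x) + s n (aug_diff P n x)).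
Proof.
move=> fg0 fd gd.
have [|x|s s0 sP] := chain_homotopy_lift (@res_projective _ _ P)
  (@aug_diff_cycle _ _ P) (@aug_diff_cycle _ _ P') (@aug_exact _ _ P')
  (f := fun n => f n \- g n).
- by move=> n x; rewrite /= fd gd -linearB.
- by rewrite /= fg0 subrr.
by exists s => // n x; rewrite -sP /= addrC subrK.
Qed.

(** * The tensor product over an algebra *)

Section TensorOverTheory.
Context (k : comNzRingType) (R : algType k) (M : lmodType R^c).
Implicit Types N : lmodType R.

Definition otimes_over N (m : M) (x : N) : @tens_over k R M N :=
  qpi (@balanced_rel k R M N) (otimes (m : restr M) (x : restr N)).

Lemma tens_over_ind N (Q : @tens_over k R M N -> Prop) :
  (forall m x, Q (otimes_over m x)) ->
  (forall c u v, Q u -> Q v -> Q (c *: u + v)) -> forall u, Q u.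
Proof.
move=> QU QD u; rewrite -(qreprK u).
elim/tens_ind: (qrepr u) => [m x|c v w Qv Qw]; first exact: QU.
by rewrite linearP; exact: QD.
Qed.

Lemma otimes_over_linear N m : linear (@otimes_over N m : restr N -> _).
Proof.
by move=> c x y; rewrite /otimes_over otimesDr otimesZr linearP.
Qed.

Lemma otimes_overDr N m (x y : N) :
  otimes_over m (x + y) = otimes_over m x + otimes_over m y.
Proof. by have := otimes_over_linear m 1 x y; rewrite !scale1r. Qed.

Lemma otimes_over0r N m : otimes_over m (0 : N) = 0.
Proof. by apply: (addrI (otimes_over m (0 : N))); rewrite -otimes_overDr !addr0. Qed.

Lemma otimes_overDl N m m' (x : N) :
  otimes_over (m + m') x = otimes_over m x + otimes_over m' x.
Proof. by rewrite /otimes_over otimesDl linearD. Qed.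

Lemma otimes_overZl N (c : k) (m : restr M) (x : N) :
  otimes_over (c *: m) x = c *: otimes_over m x.
Proof. by rewrite /otimes_over otimesZl linearZ. Qed.

Lemma otimes_overA N (r : R) m (x : N) :
  otimes_over ((r : R^c) *: m) x = otimes_over m (r *: x).
Proof.
have := qpi_gen (@balanced_rel_intro k R M N r m x).
by rewrite linearB => /eqP; rewrite subr_eq0 => /eqP.
Qed.

Lemma tens_over_mapE N N' (f : {linear N -> N'}) m x :
  tens_over_map f (otimes_over m x) = otimes_over m (f x).
Proof.
have := qlift_pi (g := qpi (@balanced_rel k R M N') \o
   tens_map (M := @restr k R^c M) (restr_map (k := k) f))
   (@tens_over_map_rel k R M N N' f) (otimes (m : restr M) (x : restr N)).
by rewrite /= tens_mapE.
Qed.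

Lemma tens_over_mapP N N' (f : {linear N -> N'}) c u v :
  @tens_over_map k R M _ _ f (c *: u + v)
  = c *: tens_over_map f u + tens_over_map f v.
Proof. exact: tens_over_map_linear. Qed.

Lemma tens_over_map_ext N N' (f g : {linear N -> N'}) :
  f =1 g -> @tens_over_map k R M _ _ f =1 tens_over_map g.
Proof.
move=> fg u; elim/tens_over_ind: u => [m x|c u v IHu IHv].
  by rewrite !tens_over_mapE fg.
by rewrite (tens_over_mapP f) (tens_over_mapP g) IHu IHv.
Qed.

Lemma tens_over_map_id N (f : {linear N -> N}) :
  f =1 id -> @tens_over_map k R M _ _ f =1 id.
Proof.
move=> f1 u; elim/tens_over_ind: u => [m x|c u v IHu IHv].
  by rewrite !tens_over_mapE f1.
by rewrite (tens_over_mapP f) IHu IHv.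
Qed.

Lemma tens_over_map_comp N N' N'' (g : {linear N' -> N''}) (f : {linear N -> N'})
    u : @tens_over_map k R M _ _ g (tens_over_map f u) = tens_over_map (g \o f) u.
Proof.
elim/tens_over_ind: u => [m x|c u v IHu IHv]; first by rewrite !tens_over_mapE.
by rewrite (tens_over_mapP f) (tens_over_mapP g) (tens_over_mapP (g \o f)) IHu IHv.
Qed.

Lemma tens_over_map_add N N' (f g : {linear N -> N'}) u :
  @tens_over_map k R M _ _ (f \+ g) u = tens_over_map f u + tens_over_map g u.
Proof.
elim/tens_over_ind: u => [m x|c u v IHu IHv].
  by rewrite !tens_over_mapE otimes_overDr.
rewrite (tens_over_mapP f) (tens_over_mapP g) (tens_over_mapP (f \+ g)).
by rewrite IHu IHv scalerDr addrACA.
Qed.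

Lemma tens_over_map0 N N' (f : {linear N -> N'}) :
  (forall x, f x = 0) -> forall u, @tens_over_map k R M _ _ f u = 0.
Proof.
move=> f0 u; elim/tens_over_ind: u => [m x|c u v IHu IHv].
  by rewrite tens_over_mapE f0 otimes_over0r.
by rewrite (tens_over_mapP f) IHu IHv scaler0 addr0.
Qed.

End TensorOverTheory.

Section ResolutionTensor.
Context (k : comNzRingType) (R : algType k) (M : lmodType R^c).
Context (N : lmodType R).
Implicit Types P : proj_resolution N.

Local Notation tmap := (@tens_over_map k R M _ _).

(** Tensoring is additive, so it preserves the homotopy between the identity and g f; on a cycle the
    summand through the differential drops out. *)
Lemma tor_map_inverse P P'
    (f : forall n, {linear aug_obj P n -> aug_obj P' n})
    (g : forall n, {linear aug_obj P' n -> aug_obj P n}) :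
    (forall x, g 0 (f 0 x) = x) ->
    (forall n x, f n (aug_diff P n x) = aug_diff P' n (f n.+1 x)) ->
    (forall n x, g n (aug_diff P' n x) = aug_diff P n (g n.+1 x)) ->
  forall n z, z \in cycle (fun i => tmap (res_diff P i)) n ->
  exists y, tmap (res_diff P n) y = z - tmap (g n.+1) (tmap (f n.+1) z).
Proof.
move=> gf0 fd gd n z zc.
have [||s s0 sP] := @resolution_homotopy _ _ P P
  (fun=> idfun) (fun n => g n \o f n) _ (fun _ _ => erefl).
- by move=> x; rewrite /= gf0.
- by move=> i x; rewrite /= fd gd.
exists (tmap (s n.+1) z).
(* In degree 0 there is no cycle condition to use: the map leaving is the augmentation, and the term
   dies because [s 0] is zero. *)
have sz : tmap (s n) (tmap (aug_diff P n) z) = 0.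
  case: n z zc => [|n] z zc.
    rewrite tens_over_map_comp; apply: tens_over_map0 => x; exact: s0.
  by move: zc; rewrite unfold_in /= => /eqP ->; rewrite linear0.
have : z = tmap (g n.+1 \o f n.+1) z +
    (tmap (aug_diff P n.+1 \o s n.+1) z + tmap (s n \o aug_diff P n) z).
  rewrite -!tens_over_map_add -[LHS](@tens_over_map_id k R M _ idfun (fun=> erefl)).
  by apply: tens_over_map_ext => x; exact: sP.
rewrite -!tens_over_map_comp sz addr0 => zE.
by rewrite {2}zE addrC addKr.
Qed.

Lemma tor_resolution P P' n d :
  has_dim (@tor k R M N P n) d -> has_dim (@tor k R M N P' n) d.
Proof.
have [f [f0 fd]] := resolution_map P P'.
have [g [g0 gd]] := resolution_map P' P.
pose F i : {linear res_obj P i -> res_obj P' i} := f i.+1.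
pose G i : {linear res_obj P' i -> res_obj P i} := g i.+1.
have Fd i x : tmap (F i) (tmap (res_diff P i) x)
    = tmap (res_diff P' i) (tmap (F i.+1) x).
  by rewrite !tens_over_map_comp; apply: tens_over_map_ext => y; exact: (fd i.+1).
have Gd i x : tmap (G i) (tmap (res_diff P' i) x)
    = tmap (res_diff P i) (tmap (G i.+1) x).
  by rewrite !tens_over_map_comp; apply: tens_over_map_ext => y; exact: (gd i.+1).
have GF z : z \in cycle (fun i => tmap (res_diff P i)) n ->
    exists y, tmap (res_diff P n) y = z - tmap (G n) (tmap (F n) z).
  by apply: tor_map_inverse => // x; rewrite f0 g0.
have FG z : z \in cycle (fun i => tmap (res_diff P' i)) n ->
    exists y, tmap (res_diff P' n) y = z - tmap (F n) (tmap (G n) z).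
  by apply: tor_map_inverse => // x; rewrite g0 f0.
have := homology_transfer (f := fun i => tmap (F i)) (g := fun i => tmap (G i))
  Fd Gd GF FG (m := d).
exact.
Qed.

End ResolutionTensor.

(** * Total complexes of double complexes *)

Section TotalComplex.
Context (S : nzRingType) (V : lmodType S).
Context (dx dy : nat -> nat -> {linear V -> V}).

Definition tot_obj n : lmodType S := {ffun 'I_n.+1 -> V}.

(* [f r] sits in bidegree (r, n + 1 - r); [dx r s] and [dy r s] are the
   differentials arriving in bidegree (r, s), and the sign of the total
   differential is carried by [dy]. *)
Definition tot_diff n (f : tot_obj n.+1) : tot_obj n :=
  [ffun r : 'I_n.+1 => dx r (n - r) (f (lift ord0 r))
                     + dy r (n - r) (f (widen_ord (leqnSn n.+1) r))].

Lemma tot_diff_linear n : linear (@tot_diff n).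
Proof.
move=> c u v; apply/ffunP=> r; rewrite !ffunE !linearP.
by rewrite scalerDr addrACA.
Qed.

HB.instance Definition _ n :=
  GRing.isLinear.Build S (tot_obj n.+1) (tot_obj n) *:%R (@tot_diff n)
    (@tot_diff_linear n).

Hypothesis dxdx : forall r s u, dx r s (dx r.+1 s u) = 0.
Hypothesis dydy : forall r s u, dy r s (dy r s.+1 u) = 0.
Hypothesis dxdy : forall r s u, dx r s (dy r.+1 s u) + dy r s (dx r s.+1 u) = 0.

Lemma tot_diffK n f : tot_diff (n := n) (tot_diff f) = 0.
Proof.
apply/ffunP=> r; rewrite !ffunE !lift0 /= subSS subSn ?leq_ord // !linearD /=.
rewrite dxdx add0r dydy addr0.
have -> : widen_ord (leqnSn n.+2) (lift ord0 r)
        = lift ord0 (widen_ord (leqnSn n.+1) r) by apply: val_inj.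
exact: dxdy.
Qed.

Context (hx : nat -> nat -> V -> V) (hy e : nat -> V -> V).
Context (p : nat -> nat -> V -> V) (p' : nat -> V -> V).
Hypothesis hxD : forall r s, {morph hx r s : u v / u + v}.
Hypothesis eD : forall s, {morph e s : u v / u + v}.
Hypothesis hx0 : forall s u, dx 0 s (hx 0 s u) = u - p 0 s u - e s u.
Hypothesis hxS : forall r s u,
  dx r.+1 s (hx r.+1 s u) + hx r s (dx r s u) = u - p r.+1 s u.
Hypothesis hxdy : forall r s u,
  hx r s (dy r s u) + dy r.+1 s (hx r s.+1 u) = 0.
Hypothesis edx : forall s u, e s (dx 0 s u) = 0.
Hypothesis edy : forall s u, e s (dy 0 s u) = dy 0 s (e s.+1 u).
Hypothesis hy0 : forall u, dy 0 0 (hy 0 (e 0 u)) = e 0 u - p' 0 u.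
Hypothesis hyS : forall s u,
  dy 0 s.+1 (hy s.+1 (e s.+1 u)) + hy s (dy 0 s (e s.+1 u))
  = e s.+1 u - p' s.+1 u.

(* The homotopy of a tensor product of complexes: hx (x) 1 + e (x) hy, where e
   is the projector left over by hx in the column r = 0. *)
Definition tot_homotopy n (f : tot_obj n) : tot_obj n.+1 :=
  [ffun r => oapp (fun r' : 'I_n.+1 => hx r' (n - r') (f r'))
                  (hy n (e n (f ord0))) (unlift ord0 r)].

(** The part that [tot_homotopy] does not contract: [p] is left over by [hx] in every column, [p']
    by [hy] in column 0. *)
Definition tot_proj n (f : tot_obj n) : tot_obj n :=
  [ffun r : 'I_n.+1 => p r (n - r) (f r) +
                       (if r == ord0 then p' n (f r) else 0)].

Lemma tot_homotopy0 f :
  tot_diff (tot_homotopy (n := 0) f) = f - tot_proj f.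
Proof.
apply/ffunP=> r; rewrite (ord1 r) !ffunE liftK /= subn0.
have -> : widen_ord (leqnSn 1) ord0 = ord0 by apply: val_inj.
by rewrite unlift_none /= hx0 hy0 addrA subrK opprD addrA.
Qed.

(** In a column r > 0, [hxS] gives the result and the mixed terms cancel by [hxdy]. In column 0,
    [hx0] leaves the defect [e]; this is contracted by [hy] along y, because [e] kills what arrives
    from column 1 and commutes with [dy]. *)
Lemma tot_homotopyS n (f : tot_obj n.+1) :
  tot_diff (tot_homotopy f) + tot_homotopy (tot_diff f) = f - tot_proj f.
Proof.
apply/ffunP=> r; rewrite !ffunE liftK /=.
case: (unliftP ord0 r) => [r' ->|->] /=; last first.
  have -> : widen_ord (leqnSn n.+2) ord0 = ord0 by apply: val_inj.
  rewrite unlift_none /= !subn0 hx0 eD edx add0r edy.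
  have -> : widen_ord (leqnSn n.+1) ord0 = ord0 by apply: val_inj.
  by rewrite -addrA hyS addrA subrK opprD addrA.
have -> : widen_ord (leqnSn n.+2) (lift ord0 r')
        = lift ord0 (widen_ord (leqnSn n.+1) r') by apply: val_inj.
rewrite liftK /= !ffunE /bump leq0n !add1n subSS subSn ?leq_ord // hxD addr0.
rewrite addrACA hxS [X in _ + X]addrC hxdy addr0.
by [].
Qed.

End TotalComplex.

(** * Tensor products with finite free modules *)

Section FreeTensor.
Context (k : comNzRingType) (R : algType k) (M : lmodType R^c) (I : finType).

Local Notation F := {ffun I -> R^o}.
Local Notation MI := {ffun I -> @restr k R^c M}.

Lemma converse_scalarC (r : R) (c : k) :
  (r : R^c) * (c%:A : R^c) = (c%:A : R^c) * (r : R^c).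
Proof. by rewrite -scalerAr -scalerAl mul1r mulr1. Qed.

Lemma ractZ (r : R) (c : k) (m : @restr k R^c M) :
  (r : R^c) *: ((c *: m : restr M) : M) = c *: (((r : R^c) *: (m : M) : M) : restr M).
Proof.
change ((r : R^c) *: ((c%:A : R^c) *: (m : M)) = (c%:A : R^c) *: ((r : R^c) *: (m : M))).
by rewrite !scalerA converse_scalarC.
Qed.

Definition ract (r : R) (m : restr M) : restr M := (r : R^c) *: (m : M).

Lemma ract_linear r : linear (ract r).
Proof. by move=> c m m'; rewrite /ract [LHS]scalerDr; congr (_ + _); exact: ractZ. Qed.

HB.instance Definition _ r :=
  GRing.isLinear.Build k (restr M) (restr M) *:%R (ract r) (ract_linear r).

Lemma ractD r r' m : ract (r + r') m = ract r m + ract r' m.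
Proof. exact: (scalerDl (m : M) (r : R^c) (r' : R^c)). Qed.

Lemma ractA r r' m : ract r (ract r' m) = ract (r' * r) m.
Proof. by rewrite /ract [LHS]scalerA. Qed.

Lemma ract_scale (c : k) r m : ract (c *: r) m = c *: ract r m.
Proof.
change ((c *: (r : R^c) : R^c) *: (m : M) = (c%:A : R^c) *: ((r : R^c) *: (m : M))).
by rewrite scalerA -scalerAl mul1r.
Qed.

Lemma ract1 m : ract 1 m = m.
Proof. exact: (scale1r (m : M)). Qed.

Lemma ract0 m : ract 0 m = 0.
Proof. exact: (scale0r (m : M)). Qed.

(** The source of the isomorphism of M (x)_R R^I with M^I, sending m (x) u to the family of all m
    u_i. *)
Definition free_tens_pure (m : restr M) (u : @restr k R F) : MI :=
  [ffun i => ract ((u : F) i : R) m].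

Lemma free_tens_pure_bilin : bilin free_tens_pure.
Proof.
split=> [u c m m'|m c u u']; apply/ffunP=> i; rewrite !ffunE.
  by rewrite linearP.
transitivity (ract (c *: ((u : F) i : R) + ((u' : F) i : R)) m).
  by congr (ract _ m); congr (_ + _); exact: mulr_algl.
by rewrite ractD ract_scale.
Qed.

Definition free_tens_lift : tens (restr M) (@restr k R F) -> MI :=
  tens_lift free_tens_pure.

HB.instance Definition _ := GRing.isLinear.Build k
  (tens (restr M) (@restr k R F)) MI *:%R free_tens_lift
  (tens_lift_linear free_tens_pure_bilin).

Lemma free_tens_lift_rel v : @balanced_rel k R M F v -> free_tens_lift v = 0.
Proof.
case=> r m u; rewrite linearB /= /free_tens_lift !(tens_liftE free_tens_pure_bilin).
apply/eqP; rewrite subr_eq0; apply/eqP/ffunP=> i.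
by rewrite !ffunE [LHS]ractA.
Qed.

Definition free_tens (x : @tens_over k R M F) : MI := free_tens_lift (qrepr x).

Lemma free_tens_linear : linear free_tens.
Proof. exact: (qlift_linear (g := free_tens_lift) free_tens_lift_rel). Qed.

HB.instance Definition _ := GRing.isLinear.Build k (@tens_over k R M F) MI *:%R
  free_tens free_tens_linear.

Lemma free_tensE m u : free_tens (otimes_over m u) = [ffun i => ract (u i : R) m].
Proof.
rewrite [LHS](qlift_pi (g := free_tens_lift) free_tens_lift_rel).
exact: tens_liftE free_tens_pure_bilin m u.
Qed.

Definition free_gen i : F := [ffun j => (i == j)%:R].

Definition free_tens_inv (w : MI) : @tens_over k R M F :=
  \sum_i otimes_over (w i : M) (free_gen i).

Lemma free_tens_inv_linear : linear free_tens_inv.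
Proof.
move=> c v w; rewrite /free_tens_inv scaler_sumr -big_split /=.
apply: eq_bigr => i _; rewrite !ffunE otimes_overDl; congr (_ + _).
exact: otimes_overZl.
Qed.

HB.instance Definition _ := GRing.isLinear.Build k MI (@tens_over k R M F) *:%R
  free_tens_inv free_tens_inv_linear.

(** Balancing moves the coordinates back: the sum of m u_i (x) e_i is m (x) the sum of u_i e_i. *)
Lemma free_tensK : cancel free_tens free_tens_inv.
Proof.
elim/tens_over_ind=> [m u|c u v IHu IHv]; last first.
  by rewrite free_tens_linear free_tens_inv_linear IHu IHv.
rewrite free_tensE /free_tens_inv.
under eq_bigr => i _ do rewrite ffunE otimes_overA.
transitivity (otimes_over m (\sum_i (u i : R) *: free_gen i)).
  apply/esym/(big_morph (@otimes_over k R M F m)); first exact: otimes_overDr.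
  exact: otimes_over0r.
congr otimes_over; apply/ffunP=> j; rewrite sum_ffunE (bigD1 j) //=.
rewrite !ffunE eqxx big1 ?addr0 => [|i /negPf ij]; first by rewrite [_ *: _]mulr1.
by rewrite !ffunE ij [_ *: _]mulr0.
Qed.

Lemma free_tens_invK : cancel free_tens_inv free_tens.
Proof.
move=> w; rewrite linear_sum; apply/ffunP=> j; rewrite sum_ffunE (bigD1 j) //=.
rewrite free_tensE !ffunE eqxx ract1 big1 ?addr0 // => i /negPf ij.
by rewrite free_tensE !ffunE ij ract0.
Qed.

End FreeTensor.

(** * Free resolutions from double complexes *)

Lemma free_projective (R : nzRingType) (I : finType) :
  projective ({ffun I -> R^o} : lmodType R).
Proof.
move=> U V g f gsurj.
have [s sP] := choice gsurj.
pose e i : {ffun I -> R^o} := [ffun j => (i == j)%:R].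
pose h (u : {ffun I -> R^o}) : U := \sum_i (u i : R) *: s (f (e i)).
have hl : linear h.
  move=> c u v; rewrite /h scaler_sumr -big_split /=; apply: eq_bigr => i _.
  by rewrite !ffunE scalerDl scalerA.
pose hL := GRing.isLinear.Build R {ffun I -> R^o} U *:%R h hl.
pose H : {linear {ffun I -> R^o} -> U} := HB.pack h hL.
exists H => u; rewrite /H /= /h linear_sum /=.
under eq_bigr => i _ do rewrite linearZ sP -linearZ.
rewrite -linear_sum; congr (f _); apply/ffunP=> j.
rewrite sum_ffunE (bigD1 j) //= big1 ?addr0 => [|i /negPf ij].
  by rewrite !ffunE eqxx [LHS]mulr1.
by rewrite !ffunE ij [LHS]mulr0.
Qed.

Section RightMultiplication.
Context (R : nzRingType).

(** Endomorphisms of the left module [R^o] are right multiplications, so composition reverses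
    products: [al r.+1 s * al r s] is the square of the x-differential. *)
Definition rmul (x : R) (u : R^o) : R^o := (u : R) * x.

Lemma rmul_linear x : linear (rmul x).
Proof. by move=> c u v; rewrite /rmul [LHS]mulrDl; congr (_ + _); rewrite -mulrA. Qed.

HB.instance Definition _ x :=
  GRing.isLinear.Build R R^o R^o *:%R (rmul x) (rmul_linear x).

End RightMultiplication.

Section FreeTotalResolution.
Context (k : comNzRingType) (R : algType k) (M : lmodType R^c) (N : lmodType R).
Context (al be : nat -> nat -> R) (aug : {linear R^o -> N}).

Local Notation dx := (fun r s => rmul (al r s) : {linear R^o -> R^o}).
Local Notation dy := (fun r s => rmul (be r s) : {linear R^o -> R^o}).
Local Notation tot n := (tot_obj (R^o : lmodType R) n).

Hypothesis alal : forall r s, al r.+1 s * al r s = 0.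
Hypothesis bebe : forall r s, be r s.+1 * be r s = 0.
Hypothesis beal : forall r s, be r.+1 s * al r s + al r s.+1 * be r s = 0.
Hypothesis aug_surj : forall x, exists u, aug u = x.
Hypothesis aug_al : forall u : R, aug (u * al 0 0) = 0.
Hypothesis aug_be : forall u : R, aug (u * be 0 0) = 0.
Hypothesis tot_exact0 : forall f : tot 0, aug (f ord0) = 0 ->
  exists f', tot_diff dx dy f' = f.
Hypothesis tot_exactS : forall n (f : tot n.+1), tot_diff dx dy f = 0 ->
  exists f', tot_diff dx dy f' = f.

Let tot_aug (f : tot 0) : N := aug (f ord0).

Let tot_aug_linear : linear tot_aug.
Proof. by move=> c u v; rewrite /tot_aug !ffunE linearP. Qed.

HB.instance Definition _ :=
  GRing.isLinear.Build R (tot 0) N *:%R tot_aug tot_aug_linear.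

Lemma free_tot_diffK n f : tot_diff dx dy (n := n) (tot_diff dx dy f) = 0.
Proof.
apply: tot_diffK => r s u; rewrite /= /rmul.
- by rewrite -mulrA alal mulr0.
- by rewrite -mulrA bebe mulr0.
- by rewrite -!mulrA -mulrDr beal mulr0.
Qed.

Lemma tot_aug_diff f : tot_aug (tot_diff dx dy f) = 0.
Proof. by rewrite /tot_aug ffunE linearD /= /rmul aug_al aug_be addr0. Qed.

(** Closed transparently, so that its terms and differentials still compute in
    [tor_free_resolution]. *)
Definition free_resolution : proj_resolution N.
Proof.
apply: (@ProjResolution R N (fun n => tot n) (fun n => @tot_diff R R^o dx dy n)
  tot_aug) => [n|x|f|n f].
- exact: free_projective.
- by have [u ux] := aug_surj x; exists [ffun=> u]; rewrite /= /tot_aug ffunE.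
- by split=> [/tot_exact0|[f' <-]] //; exact: tot_aug_diff.
- by split=> [/tot_exactS|[f' <-]] //; exact: free_tot_diffK.
Defined.

Local Notation ax := (fun r s => ract (al r s) : {linear restr M -> restr M}).
Local Notation ay := (fun r s => ract (be r s) : {linear restr M -> restr M}).
Local Notation totM n := (tot_obj (@restr k R^c M : lmodType k) n).
Local Notation MT n := (@tens_over k R M (tot n)).

Lemma free_tens_diff n (z : MT n.+1) :
  free_tens (tens_over_map (@tot_diff R R^o dx dy n) z)
  = tot_diff ax ay (free_tens z).
Proof.
elim/tens_over_ind: z => [m u|c u v IHu IHv]; last first.
  by rewrite (tens_over_mapP (@tot_diff R R^o dx dy n)) !free_tens_linear
    tot_diff_linear IHu IHv.
rewrite tens_over_mapE !free_tensE; apply/ffunP=> r; rewrite !ffunE.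
by rewrite ractD -!ractA.
Qed.

Lemma tor_free_resolution n d :
  has_dim (homology (fun n => @tot_diff k _ ax ay n) n) d ->
  has_dim (@tor k R M N free_resolution n) d.
Proof.
pose F n : {linear totM n -> MT n} := @free_tens_inv k R M 'I_n.+1.
pose G n : {linear MT n -> totM n} := @free_tens k R M 'I_n.+1.
pose D n : {linear totM n.+1 -> totM n} := @tot_diff k _ ax ay n.
pose E n : {linear MT n.+1 -> MT n} := tens_over_map (@tot_diff R R^o dx dy n).
have GE i x : G i (E i x) = D i (G i.+1 x) by exact: free_tens_diff.
have FD i x : F i (D i x) = E i (F i.+1 x).
  by rewrite -[RHS]free_tensK [free_tens _]GE [G _ _]free_tens_invK.
(* [F] and [G] are mutually inverse already on chains, so the boundary to be found is that of 0. *)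
have GF z : z \in cycle D n -> exists y, D n y = z - G n (F n z).
  by move=> _; exists 0; rewrite linear0 [G _ _]free_tens_invK subrr.
have FG z : z \in cycle E n -> exists y, E n y = z - F n (G n z).
  by move=> _; exists 0; rewrite linear0 [F _ _]free_tensK subrr.
have := homology_transfer FD GE GF FG (m := d).
exact.
Qed.

End FreeTotalResolution.

(** * The monomial basis of the quantum complete intersection *)

Lemma malg_monomial_ind (k : nzRingType) (K : choiceType)
    (Q : {malg k[K]} -> Prop) :
  Q 0 -> (forall c m u, Q u -> Q (c *: << m >> + u)) -> forall u, Q u.
Proof.
move=> Q0 QD u; rewrite (monalgE u); elim: (X in \sum_(i <- X) _) => [|m s IHs].
  by rewrite big_nil.
rewrite big_cons; have -> : << u@_m *g m >> = u@_m *: << m >>; last exact: QD.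
by apply/malgP=> x; rewrite mcoeffZ !mcoeffU mulrnAr mulr1.
Qed.

Lemma malgUU (k : nzRingType) (K : monomType) (m m' : K) :
  (<< m >> : {malg k[K]}) * << m' >> = << mmul m m' >>.
Proof. by rewrite malgM_def fgmulUU mulr1. Qed.

Lemma malg_scaleAr (k : comNzRingType) (K : monomType) (c : k)
    (u v : {malg k[K]}) : u * (c *: v) = c *: (u * v).
Proof.
apply/malgP=> m; rewrite mcoeffZ (mcoeffMlw (d1 := msupp u) (d2 := msupp v)) //.
  rewrite mcoeffMl mulr_sumr; apply: eq_bigr => m1 _.
  rewrite mulr_sumr; apply: eq_bigr => m2 _.
  by rewrite mcoeffZ mulrnAr mulrCA.
exact: msuppZ_le.
Qed.

Lemma malg_linear_eq0 (k : comNzRingType) (K : choiceType) (U : lmodType k)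
    (f : {malg k[K]} -> U) :
  linear f -> (forall m, f << m >> = 0) -> forall u, f u = 0.
Proof.
move=> fl fm; elim/malg_monomial_ind=> [|c m u fu].
  by apply: (addrI (f 0)); rewrite addr0 -{1 3}[f 0]scale1r -fl scaler0 addr0 scale1r.
by rewrite fl fm fu scaler0 addr0.
Qed.

Section NormalForm.
Context (k : fieldType) (a b : nat) (q : k).
Hypothesis q_neq0 : q != 0.

Let X : 'I_2 := ord0.
Let Y : 'I_2 := ord_max.

Definition word_degree (i : 'I_2) (w : seq 'I_2) : nat := count_mem i w.

(* In A the word w equals [word_coef w] times x^i y^j, since y x = q^-1 x y. *)
Fixpoint word_coef (w : seq 'I_2) : k :=
  if w is i :: w' then
    (if i == ord0 then 1 else q^-1 ^+ word_degree ord0 w') * word_coef w'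
  else 1.

(** To normalise the concatenation, each Y of [w] passes each X of [w'], at the price of one q^-1
    per pair. *)
Lemma word_coef_cat w w' : word_coef (w ++ w') =
  q^-1 ^+ (word_degree Y w * word_degree X w') * (word_coef w * word_coef w').
Proof.
elim: w => [|i w IHw] /=; first by rewrite mul0n !mul1r.
rewrite IHw /word_degree /= count_cat; case: ifP => [/eqP->|iX].
  by rewrite !mul1r.
have -> : i == Y.
  by case: i iX => -[|[|]].
by rewrite mulnDl mul1n !exprD; rewrite -!mulrA mulrCA; congr (_ * _); rewrite mulrCA.
Qed.

Lemma word_coef_normal m n : word_coef (nseq m X ++ nseq n Y) = 1.
Proof.
elim: m => [|m IHm] /=; last by rewrite mul1r.
elim: n => // n IHn; rewrite /= IHn /word_degree count_nseq mul0n expr0.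
by rewrite mulr1.
Qed.

(** The coefficient of x^i y^j in the normal form of a word. Its linear extension will descend to A
    as a dual basis vector, which proves independence of the monomials. *)
Definition word_functional (i j : nat) (m : {fmonom 'I_2}) : k^o :=
  if (word_degree X m == i) && (word_degree Y m == j) then word_coef m else 0.

Definition normal_coef (i j : nat) : {linear free_alg2 k -> k^o} :=
  free_lift (word_functional i j).

Lemma normal_coefU i j m :
  normal_coef i j (<< m >> : free_alg2 k) = word_functional i j m.
Proof. exact: free_liftU. Qed.

Lemma exp_gen (i : 'I_2) n :
  exists2 m : {fmonom 'I_2}, (<< fmu i >> : free_alg2 k) ^+ n = << m >>
  & (m : seq 'I_2) = nseq n i.
Proof.
elim: n => [|n [m IHn mE]]; first by exists mone; rewrite ?fm1.
by exists (mmul (fmu i) m); rewrite ?exprS ?IHn ?malgUU // fmM fmU mE.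
Qed.

(** A word containing X^a or Y^b has too large a degree to be seen by the functional. The words m XY
    m' and m YX m' have equal degrees, and their coefficients differ by exactly the factor q^-1. *)
Lemma normal_coef_rel i j s (m m' : {fmonom 'I_2}) :
  (i < a)%N -> (j < b)%N -> qci_rel q a b s ->
  normal_coef i j (<< m >> * s * << m' >>) = 0.
Proof.
move=> ia jb [->|->|->].
- have [w -> wE] := exp_gen X a.
  rewrite !malgUU normal_coefU /word_functional !fmM wE /word_degree.
  rewrite !count_cat count_nseq /= ?eqxx mul1n; case: eqP => // iE.
  by move: ia; rewrite -iE ltnNge (leq_trans (leq_addl _ _) (leq_addr _ _)).
- have -> : << m >> * (Xgen k * Ygen k - q *: (Ygen k * Xgen k)) * << m' >>
     = << mmul (mmul m (mmul (fmu X) (fmu Y))) m' >>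
       - q *: << mmul (mmul m (mmul (fmu Y) (fmu X))) m' >>
       :> free_alg2 k.
    rewrite mulrBr mulrBl [Xgen k * _]malgUU [Ygen k * _]malgUU !malgUU.
    congr (_ - _).
    by rewrite malg_scaleAr malgUU -scalerAl malgUU.
  rewrite linearB linearZ /= !normal_coefU /word_functional !fmM !fmU.
  rewrite /word_degree !count_cat /=; case: ifP; last first.
    by rewrite [_ *: 0]mulr0 subrr.
  move=> _; rewrite !word_coef_cat /= /word_degree !count_cat /=.
  rewrite !add0n !addn0 expr0 expr1 !mul1r !mulr1.
  have cancel_q (u v w z : k) :
    u * (v * w * z) - q * (u * (v * (w * q^-1) * z)) = 0 by field.
  exact: cancel_q.
have [w -> wE] := exp_gen Y b.
rewrite !malgUU normal_coefU /word_functional !fmM wE /word_degree.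
rewrite !count_cat !count_nseq /= ?eqxx mul1n andbC; case: eqP => // jE.
by move: jb; rewrite -jE ltnNge (leq_trans (leq_addl _ _) (leq_addr _ _)).
Qed.

Lemma normal_coef_ideal i j u : (i < a)%N -> (j < b)%N ->
  two_sided_ideal (qci_rel q a b) u -> normal_coef i j u = 0.
Proof.
move=> ia jb; elim=> [x s y rs||u' v' _ Iu _ Iv]; last 2 first.
- exact: linear0.
- by rewrite linearD Iu Iv addr0.
apply: (@malg_linear_eq0 k _ k^o (fun x => normal_coef i j (x * s * y))).
  by move=> c u' v' /=; rewrite -linearP; congr (normal_coef i j _);
    rewrite 2!mulrDl -!scalerAl.
move=> m; apply: (@malg_linear_eq0 k _ k^o (fun y => normal_coef i j (<< m >> * s * y))).
  by move=> c u' v' /=; rewrite -linearP mulrDr; congr (normal_coef i j (_ + _));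
    exact: malg_scaleAr.
by move=> m'; exact: normal_coef_rel.
Qed.

End NormalForm.

Section QuotientBasis.
Context (k : fieldType) (a b : nat) (q : k).
Hypothesis q_neq0 : q != 0.
Context (A : algType k) (pi : {lrmorphism free_alg2 k -> A}).
Hypothesis A_def : is_quotient pi (qci_rel q a b).

Let x := pi (Xgen k).
Let y := pi (Ygen k).

Lemma qci_rel_eq0 s : qci_rel q a b s -> pi s = 0.
Proof.
move=> rs; apply/A_def.2; rewrite -[s]mul1r -[_ * s]mulr1.
exact: two_sided_ideal_gen.
Qed.

Lemma qci_xa : x ^+ a = 0.
Proof. by rewrite -rmorphXn; apply: qci_rel_eq0; constructor. Qed.

Lemma qci_yb : y ^+ b = 0.
Proof. by rewrite -rmorphXn; apply: qci_rel_eq0; constructor 3. Qed.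

Lemma qci_xy : x * y = q *: (y * x).
Proof.
apply/eqP; rewrite -subr_eq0 -!rmorphM -linearZ -linearB; apply/eqP.
by apply: qci_rel_eq0; constructor 2.
Qed.

Let yxn n : y * x ^+ n = q^-1 ^+ n *: (x ^+ n * y).
Proof.
have yx : y * x = q^-1 *: (x * y) by rewrite qci_xy scalerA mulVf ?scale1r.
elim: n => [|n IHn]; first by rewrite !expr0 mulr1 mul1r scale1r.
rewrite [in LHS]exprSr mulrA IHn -scalerAl -[_ * y * x]mulrA yx -scalerAr scalerA.
by rewrite -exprSr mulrA -exprSr.
Qed.

Lemma qci_word (m : {fmonom 'I_2}) : pi << m >> = word_coef q m *:
  (x ^+ word_degree ord0 m * y ^+ word_degree ord_max m).
Proof.
case: m; elim=> [|i w IHw].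
  rewrite /= !expr0 mulr1 scale1r -fmoneE; exact: rmorph1.
have pM : pi << FMonom (i :: w) >> = pi << fmu i >> * pi << FMonom w >>.
  rewrite -rmorphM; congr (pi _); rewrite malgUU; congr << _ >>.
  by apply/eqP; rewrite fmP fmM fmU.
rewrite pM IHw /= -scalerAr mulrA /word_degree /=.
case: (altP (i =P ord0)) => [->|i0].
  by rewrite mul1r exprS.
have -> : i = ord_max by case: i i0 {pM} => -[|[|]] // i1 _; apply: val_inj.
rewrite /= add0n add1n -/y yxn -scalerAl scalerA mulrC -mulrA -exprS.
by [].
Qed.

(** Words normalise to multiples of x^i y^j, which gives spanning; the functionals [normal_coef]
    vanish on the ideal, hence descend to A and give the dual basis. *)
Lemma quotient_basis : exists C : 'I_a -> 'I_b -> {linear A -> k^o},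
  (forall i j i' j', C i j (x ^+ (i' : 'I_a) * y ^+ (j' : 'I_b))
     = ((i == i') && (j == j'))%:R) /\
  (forall t, t = \sum_i \sum_j C i j t *: (x ^+ i * y ^+ j)).
Proof.
have [lift liftP'] := choice A_def.1.
have pi0 u : pi u = 0 -> two_sided_ideal (qci_rel q a b) u := (A_def.2 u).1.
have piB u v : pi (u - v) = pi u - pi v by exact: rmorphB.
have piP c u v : pi (c *: u + v) = c *: pi u + pi v by exact: linearP.
have liftP t : pi (lift t) = t := liftP' t.
(* Defined through an arbitrary section of [pi], not assumed linear; [CE] shows that the choice is
   immaterial, and linearity follows. *)
pose C i j t : k^o := normal_coef q i j (lift t).
have CE (i : 'I_a) (j : 'I_b) u : C i j (pi u) = normal_coef q i j u.
  apply/eqP; rewrite -subr_eq0 -linearB; apply/eqP.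
  apply: (@normal_coef_ideal k a b q q_neq0) => //.
  by apply: pi0; rewrite piB liftP subrr.
have Cl (i : 'I_a) (j : 'I_b) : linear (C i j).
  move=> c t t'; rewrite -(liftP t) -(liftP t') -piP !CE.
  exact: linearP.
pose CL (i : 'I_a) (j : 'I_b) : {linear A -> k^o} :=
  HB.pack (C i j) (GRing.isLinear.Build k A k^o *:%R (C i j) (Cl i j)).
have Cxy (i i' : 'I_a) (j j' : 'I_b) :
    C i j (x ^+ i' * y ^+ j') = ((i == i') && (j == j'))%:R.
  have [m mE mw] := exp_gen k ord0 i'; have [m' mE' mw'] := exp_gen k ord_max j'.
  rewrite -!rmorphXn -rmorphM CE mE mE' malgUU normal_coefU.
  rewrite /word_functional fmM mw mw' /word_degree !count_cat !count_nseq /=.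
  rewrite !mul0n !mul1n addn0 add0n word_coef_normal.
  by rewrite -!val_eqE /= eq_sym [_ == j :> nat]eq_sym; case: andb.
pose S t := t = \sum_(i < a) \sum_(j < b) C i j t *: (x ^+ i * y ^+ j).
have Sl c t t' : S t -> S t' -> S (c *: t + t').
  rewrite /S => tE t'E; rewrite {1}tE {1}t'E scaler_sumr -big_split /=.
  apply: eq_bigr => i _; rewrite scaler_sumr -big_split /=; apply: eq_bigr => j _.
  by rewrite Cl scalerDl scalerA.
have S0 : S 0.
  rewrite /S big1 // => i _; rewrite big1 // => j _.
  by rewrite (_ : C i j 0 = 0) ?scale0r //; exact: (linear0 (CL i j)).
(* Words produce unbounded exponents, so the range where x^i y^j is zero has to be covered too. *)
have Sxy i j : S (x ^+ i * y ^+ j).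
  have [ia|ai] := ltnP i a; last first.
    by rewrite -(subnK ai) exprD qci_xa mulr0 mul0r.
  have [jb|bj] := ltnP j b; last first.
    by rewrite -(subnK bj) exprD qci_yb !mulr0.
  have Cij i' j' : (i' < a)%N -> (j' < b)%N ->
      C i' j' (x ^+ i * y ^+ j) = ((i' == i) && (j' == j))%:R.
    move=> i'a j'b; exact: (Cxy (Ordinal i'a) (Ordinal ia) (Ordinal j'b) (Ordinal jb)).
  rewrite /S (bigD1 (Ordinal ia)) //= (bigD1 (Ordinal jb)) //=.
  rewrite Cij // !eqxx scale1r.
  rewrite [X in _ + X + _]big1 => [|j']; last first.
    by rewrite -val_eqE Cij //= => /negPf ->; rewrite andbF scale0r.
  rewrite [X in _ + X]big1 ?addr0 // => i'.
  rewrite -val_eqE /= => /negPf i'i; rewrite big1 // => j' _.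
  by rewrite Cij // i'i scale0r.
exists CL; split=> [i j i' j'|t]; first exact: Cxy.
have [u <-] : exists u, pi u = t := A_def.1 t.
suff : S (pi u) by [].
elim/malg_monomial_ind: u => [|c m u Su]; first by rewrite linear0.
rewrite piP qci_word scalerA; exact: Sl.
Qed.

End QuotientBasis.

(** * The bimodule resolution in one variable *)

Section OneVariable.
Context (U : zmodType) (a : nat).
Implicit Types phi : nat -> nat -> U.

(* [phi i k] stands for x^i e_r x^k: [bar_diff r] is the differential of
   e_(r+1), and [bar_htpy r] the right k[x]-linear homotopy, on e_r. *)
Definition bar_diff r phi i k : U :=
  if odd r then \sum_(c < a) phi (i + c)%N (k + (a.-1 - c))%N
  else phi i.+1 k - phi i k.+1.

Definition bar_htpy r phi i k : U :=
  if (i < a)%N then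
    if odd r then (if i == a.-1 then phi 0%N k else 0)
    else \sum_(c < i) phi c (i.-1 - c + k)%N
  else 0.

(** With x and x' for the left and right variable, the homotopy on e_0 is the difference quotient
    (x^i - x'^i) / (x - x'). Composing with x - x' telescopes and leaves the term with all powers
    moved to the right. *)
Lemma bar_htpy_diff phi i k : (i < a)%N ->
  bar_htpy 0 (bar_diff 0 phi) i k = phi i k - phi 0%N (i + k)%N.
Proof.
rewrite /bar_htpy => -> /=; elim: i k => [|i IHi] k.
  by rewrite big_ord0 subrr.
rewrite big_ord_recr /= subnn add0n.
transitivity (\sum_(c < i) bar_diff 0 phi c (i.-1 - c + k.+1)%N + bar_diff 0 phi i k).
  congr (_ + _); apply: eq_bigr => c _; congr bar_diff.
  by have := ltn_ord c; lia.
by rewrite IHi /bar_diff /= addrC addrA subrK addnS addSn.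
Qed.

(** For odd r the first summand telescopes to [phi i k - phi 0 (i + k)], and in the second only c =
    a - 1 - i reaches the top exponent, restoring [phi 0 (i + k)]. For even r two difference
    quotients differ by [phi i k]; when i = a - 1 the longer one is cut off by x^a = 0 and the norm
    sum from degree r + 1 takes its place. *)
Lemma bar_homotopy phi r i k : (i < a)%N ->
  bar_htpy r.+1 (bar_diff r.+1 phi) i k + bar_diff r (bar_htpy r phi) i k
  = phi i k.
Proof.
move=> ia; case r_odd: (odd r).
  have -> : bar_htpy r.+1 (bar_diff r.+1 phi) i k = bar_htpy 0 (bar_diff 0 phi) i k.
    by rewrite /bar_htpy /bar_diff /= r_odd.
  rewrite bar_htpy_diff // /bar_diff r_odd.
  have ia' : (a.-1 - i < a)%N by lia.
  rewrite (bigD1 (Ordinal ia')) //= big1 => [|c].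
    rewrite /bar_htpy r_odd subnKC ?leqnn; last by lia.
    rewrite eqxx (_ : a.-1 < a)%N ?addr0; last by lia.
    by rewrite (_ : k + (a.-1 - (a.-1 - i)) = i + k)%N ?subrK //; lia.
  rewrite -val_eqE /= => ci; rewrite /bar_htpy r_odd.
  by case: ifP => //; case: eqP => // ic; lia.
rewrite {1}/bar_htpy /= r_odd ia /= /bar_diff /= r_odd /=.
rewrite /bar_htpy r_odd ia.
case: eqP => [->|i_neq].
  rewrite prednK ?ltnn ?sub0r; last by lia.
  case: a ia => // a' _; rewrite big_ord_recr /= subnn addn0 add0n.
  rewrite addrAC -sumrB big1 ?add0r // => c _.
  by apply/eqP; rewrite subr_eq0; apply/eqP; congr phi; have := ltn_ord c; lia.
rewrite (_ : i.+1 < a)%N ?add0r; last by lia.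
rewrite big_ord_recr /= subnn add0n addrAC -sumrB big1 ?add0r // => c _.
by apply/eqP; rewrite subr_eq0; apply/eqP; congr phi; have := ltn_ord c; lia.
Qed.

(** This is (x - x') times the sum of the x^c x'^(a-1-c), which equals x^a - x'^a. In either order
    the composite telescopes along [psi], whose two ends are out of range. *)
Lemma bar_diff_diff phi r i k :
  (forall i k, (a <= i)%N || (a <= k)%N -> phi i k = 0) ->
  bar_diff r.+1 (bar_diff r phi) i k = 0.
Proof.
move=> phi0; pose psi c := phi (i + c)%N (k + (a - c))%N.
suff -> : bar_diff r.+1 (bar_diff r phi) i k = psi a - psi 0%N.
  by rewrite /psi !phi0 ?subrr ?addn0 ?subn0 ?leq_addl ?orbT.
rewrite -(telescope_sumr psi) // big_mkord /bar_diff /=.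
have psiS c : (c < a)%N -> psi c.+1 = phi (i + c).+1 (k + (a.-1 - c))%N.
  by move=> ca; rewrite /psi addnS; congr (phi _ (k + _)%N); lia.
have psiE c : (c < a)%N -> psi c = phi (i + c)%N (k + (a.-1 - c)).+1.
  by move=> ca; rewrite /psi -addnS; congr (phi _ (k + _)%N); lia.
case: (odd r) => /=.
  rewrite -sumrB; apply: eq_bigr => c _.
  by rewrite psiS // psiE // addSn addSn.
by apply: eq_bigr => c _; rewrite psiS // psiE.
Qed.

Lemma eq_bar_diff phi psi r i k :
  phi =2 psi -> bar_diff r phi i k = bar_diff r psi i k.
Proof. by move=> e; rewrite /bar_diff !e; under eq_bigr => c _ do rewrite e. Qed.

Lemma eq_bar_htpy phi psi r i k :
  phi =2 psi -> bar_htpy r phi i k = bar_htpy r psi i k.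
Proof. by move=> e; rewrite /bar_htpy !e; under eq_bigr => c _ do rewrite e. Qed.

Lemma bar_diffB phi psi r i k :
  bar_diff r (fun i k => phi i k - psi i k) i k
  = bar_diff r phi i k - bar_diff r psi i k.
Proof.
rewrite /bar_diff; case: ifP => _; first by rewrite sumrB.
by rewrite opprD addrACA -opprD.
Qed.

Lemma bar_htpyB phi psi r i k :
  bar_htpy r (fun i k => phi i k - psi i k) i k
  = bar_htpy r phi i k - bar_htpy r psi i k.
Proof.
rewrite /bar_htpy sumrB; case: ifP => _; last by rewrite subrr.
by case: ifP => _ //; case: ifP => _ //; rewrite subrr.
Qed.

Lemma bar_diff_sum (phi : nat -> nat -> nat -> U) n r i k :
  bar_diff r (fun i k => \sum_(c < n) phi c i k) i k
  = \sum_(c < n) bar_diff r (phi c) i k.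
Proof.
rewrite /bar_diff; case: ifP => _; first by rewrite exchange_big.
by rewrite sumrB.
Qed.

Lemma bar_htpy_sum (phi : nat -> nat -> nat -> U) n r i k :
  bar_htpy r (fun i k => \sum_(c < n) phi c i k) i k
  = \sum_(c < n) bar_htpy r (phi c) i k.
Proof.
rewrite /bar_htpy; case: ifP => _; last by rewrite big1.
case: ifP => _; last by rewrite exchange_big.
by case: ifP => // _; rewrite big1.
Qed.

End OneVariable.

Section Additive.
Context (U V : zmodType) (a : nat) (f : {additive U -> V}).

Lemma raddf_bar_diff phi r i k :
  f (bar_diff a r phi i k) = bar_diff a r (fun i k => f (phi i k)) i k.
Proof. by rewrite /bar_diff; case: ifP => _; rewrite (raddf_sum, raddfB). Qed.

Lemma raddf_bar_htpy phi r i k :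
  f (bar_htpy a r phi i k) = bar_htpy a r (fun i k => f (phi i k)) i k.
Proof.
rewrite /bar_htpy; case: ifP => _; last exact: raddf0.
case: ifP => _; last exact: raddf_sum.
by case: ifP => // _; exact: raddf0.
Qed.

End Additive.

Section Commutation.
Context (U : zmodType) (a b : nat) (phi : nat -> nat -> nat -> nat -> U).

Lemma bar_diffC r s i k j l :
  bar_diff a r (fun i k => bar_diff b s (phi i k) j l) i k
  = bar_diff b s (fun j l => bar_diff a r (fun i k => phi i k j l) i k) j l.
Proof.
have E psi : bar_diff b s psi j l
    = if odd s then \sum_(c < b) psi (j + c)%N (l + (b.-1 - c))%N
      else psi j.+1 l - psi j l.+1 by [].
rewrite E (@eq_bar_diff U a _ _ r i k (fun i k => E _ (phi i k))); case: ifP => _.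
  exact: (bar_diff_sum a (fun c i k => phi i k (j + c)%N (l + (b.-1 - c))%N)).
exact: bar_diffB.
Qed.

Lemma bar_htpy_diffC r s i k j l :
  bar_htpy a r (fun i k => bar_diff b s (phi i k) j l) i k
  = bar_diff b s (fun j l => bar_htpy a r (fun i k => phi i k j l) i k) j l.
Proof.
rewrite /bar_diff; case: ifP => _.
  exact: (bar_htpy_sum a (fun c i k => phi i k (j + c)%N (l + (b.-1 - c))%N)).
exact: bar_htpyB.
Qed.

End Commutation.

(** * The bimodule resolution in two variables *)

Lemma qcommute_exp (k : fieldType) (R : algType k) (q : k) (u v : R) m n :
  u * v = q *: (v * u) -> u ^+ m * v ^+ n = q ^+ (m * n) *: (v ^+ n * u ^+ m).
Proof.
move=> uv; have uvn : u * v ^+ n = q ^+ n *: (v ^+ n * u).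
  elim: n => [|n IHn]; first by rewrite !expr0 mulr1 mul1r scale1r.
  rewrite [v ^+ _]exprS mulrA uv -scalerAl -[v * u * _]mulrA IHn -scalerAr.
  by rewrite scalerA -[q * _]exprS mulrA.
elim: m => [|m IHm]; first by rewrite !expr0 mulr1 mul1r scale1r.
rewrite [u ^+ _]exprS -mulrA IHm -scalerAr [u * (v ^+ n * _)]mulrA uvn -scalerAl scalerA.
by rewrite -[v ^+ n * u * _]mulrA -[q ^+ _ * _]exprD mulSn addnC.
Qed.

(* The internal degree of the generator of the r-th term of the minimal
   bimodule resolution of k[x]/(x^a). *)
Definition gen_deg a r := (a * r./2 + odd r)%N.

Lemma gen_degS a r : (0 < a)%N ->
  gen_deg a r.+1 = (gen_deg a r + (if odd r then a.-1 else 1))%N.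
Proof.
move=> a0; rewrite /gen_deg /= uphalf_half; case: (odd r) => /=; last by lia.
by rewrite add1n mulnS; lia.
Qed.

Section Differentials.
Context (K : fieldType) (R : algType K) (a b : nat) (q : K) (X Y X' Y' : R).
Hypothesis a_gt0 : (0 < a)%N.
Hypothesis b_gt0 : (0 < b)%N.
Hypothesis q_neq0 : q != 0.
Hypothesis Xa : X ^+ a = 0.
Hypothesis X'a : X' ^+ a = 0.
Hypothesis Yb : Y ^+ b = 0.
Hypothesis Y'b : Y' ^+ b = 0.
Hypothesis XY : X * Y = q *: (Y * X).
Hypothesis Y'X' : Y' * X' = q *: (X' * Y').
Hypothesis XX' : GRing.comm X X'.
Hypothesis XY' : GRing.comm X Y'.
Hypothesis YX' : GRing.comm Y X'.
Hypothesis YY' : GRing.comm Y Y'.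

(* [alpha r s] and [beta r s] are the components of the differential from
   e_(r+1,s), resp. e_(r,s+1), to e_(r,s); the primed variables are x and y
   acting from the right. *)
Definition alpha r s : R :=
  if odd r then
    \sum_(c < a) q ^+ ((a.-1 - c) * gen_deg b s) *: (X ^+ c * X' ^+ (a.-1 - c))
  else X - q ^+ gen_deg b s *: X'.

Definition beta r s : R := (-1) ^+ r *:
  (if odd s then
    \sum_(c < b) q ^+ (c * gen_deg a r) *: (Y ^+ c * Y' ^+ (b.-1 - c))
  else q ^+ gen_deg a r *: Y - Y').

(** The primed factors stand in reverse order because they multiply in the converse algebra: in A^e
    this is x^i y^j (x) x^k y^l. *)
Definition monom i k j l : R := X ^+ i * Y ^+ j * (Y' ^+ l * X' ^+ k).

(* With e_(r,s) the generator in bidegree (r, s), this is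
   (x^i e_r x^k)(y^j e_s y^l) rewritten as a multiple of e_(r,s), where
   y^j passes e_r x^k and x^k passes e_s. *)
Definition emonom r s i k j l : R :=
  q ^+ (j * gen_deg a r + k * gen_deg b s + j * k) *: monom i k j l.

Lemma monom_eq0 i k j l : [|| a <= i, a <= k, b <= j | b <= l]%N ->
  monom i k j l = 0.
Proof.
rewrite /monom; case/or4P=> h.
- by rewrite -(subnK h) exprD Xa mulr0 !mul0r.
- by rewrite -(subnK h) [X' ^+ _]exprD X'a !mulr0.
- by rewrite -(subnK h) [Y ^+ _]exprD Yb !mulr0 mul0r.
by rewrite -(subnK h) [Y' ^+ _]exprD Y'b mulr0 mul0r mulr0.
Qed.

Lemma emonom_eq0 r s i k j l : [|| a <= i, a <= k, b <= j | b <= l]%N ->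
  emonom r s i k j l = 0.
Proof. by move=> h; rewrite /emonom monom_eq0 ?scaler0. Qed.

(** Only X^c has to pass something that does not commute with it, namely Y^j; X'^d already stands
    next to X'^k. *)
Lemma monomX i k j l c d :
  q ^+ (j * c) *: (monom i k j l * (X ^+ c * X' ^+ d))
  = monom (i + c) (k + d) j l.
Proof.
rewrite /monom [X ^+ (i + c)]exprD [X' ^+ (k + d)]exprD.
have -> : X ^+ i * Y ^+ j * (Y' ^+ l * X' ^+ k) * (X ^+ c * X' ^+ d)
   = X ^+ i * (Y ^+ j * X ^+ c) * (Y' ^+ l * (X' ^+ k * X' ^+ d)).
  have cX : X ^+ c * (Y' ^+ l * X' ^+ k) = Y' ^+ l * X' ^+ k * X ^+ c.
    apply: commrM; first exact/commrX/commr_sym/commrX/commr_sym.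
    exact/commrX/commr_sym/commrX/commr_sym.
  by rewrite -!mulrA [Y' ^+ l * (X' ^+ k * (X ^+ c * _))]mulrA
    [_ * (X ^+ c * _)]mulrA -cX !mulrA.
rewrite scalerAl; congr (_ * _).
by rewrite scalerAr -mulrA (qcommute_exp _ _ XY) mulnC.
Qed.

Lemma monomY i k j l c d :
  q ^+ (k * d) *: (monom i k j l * (Y ^+ c * Y' ^+ d))
  = monom i k (j + c) (l + d).
Proof.
rewrite /monom [Y ^+ (j + c)]exprD [Y' ^+ (l + d)]exprD.
have -> : X ^+ i * Y ^+ j * (Y' ^+ l * X' ^+ k) * (Y ^+ c * Y' ^+ d)
   = X ^+ i * (Y ^+ j * Y ^+ c) * (Y' ^+ l * (X' ^+ k * Y' ^+ d)).
  have cY : Y ^+ c * (Y' ^+ l * X' ^+ k) = Y' ^+ l * X' ^+ k * Y ^+ c.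
    apply: commrM; first exact/commrX/commr_sym/commrX/commr_sym.
    exact/commrX/commr_sym/commrX/commr_sym.
  by rewrite -!mulrA [Y' ^+ l * (X' ^+ k * (Y ^+ c * _))]mulrA
    [_ * (Y ^+ c * _)]mulrA -cY !mulrA.
rewrite scalerAr; congr (_ * _).
by rewrite -mulrA (qcommute_exp _ _ Y'X') scalerAr mulnC.
Qed.

(** The hypothesis says that the differential preserves internal degree; this is what makes the
    powers of q in the two normalisations agree. *)
Lemma emonomX r s i k j l c d :
  (gen_deg a r.+1 = gen_deg a r + c + d)%N ->
  q ^+ (d * gen_deg b s) *: (emonom r.+1 s i k j l * (X ^+ c * X' ^+ d))
  = emonom r s (i + c) (k + d) j l.
Proof.
move=> e; rewrite /emonom -scalerAl -monomX !scalerA -!exprD e.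
by congr (_ ^+ _ *: _); lia.
Qed.

Lemma emonomY r s i k j l c d :
  (gen_deg b s.+1 = gen_deg b s + c + d)%N ->
  q ^+ (c * gen_deg a r) *: (emonom r s.+1 i k j l * (Y ^+ c * Y' ^+ d))
  = emonom r s i k (j + c) (l + d).
Proof.
move=> e; rewrite /emonom -scalerAl -monomY !scalerA -!exprD e.
by congr (_ ^+ _ *: _); lia.
Qed.

(** The gain of the normalisation: no power of q remains, so every identity about [alpha] and [beta]
    reduces to one-variable statements about [bar_diff]. *)
Lemma emonom_alpha r s i k j l :
  emonom r.+1 s i k j l * alpha r s
  = bar_diff a r (fun i k => emonom r s i k j l) i k.
Proof.
have := gen_degS r a_gt0; rewrite /alpha /bar_diff; case: ifP => r_odd eD.
  rewrite mulr_sumr; apply: eq_bigr => c _; rewrite -scalerAr emonomX //.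
  by have := ltn_ord c; lia.
have <- : emonom r.+1 s i k j l * X = emonom r s i.+1 k j l.
  have := @emonomX r s i k j l 1 0; rewrite [(i + 1)%N]addn1 [(k + 0)%N]addn0.
  by rewrite mul0n expr1 !expr0 mulr1 scale1r; apply; lia.
have <- : q ^+ gen_deg b s *: (emonom r.+1 s i k j l * X') = emonom r s i k.+1 j l.
  have := @emonomX r s i k j l 0 1; rewrite [(k + 1)%N]addn1 [(i + 0)%N]addn0.
  by rewrite mul1n expr1 !expr0 mul1r; apply; lia.
by rewrite mulrBr -scalerAr.
Qed.

Lemma emonom_beta r s i k j l :
  emonom r s.+1 i k j l * beta r s
  = (-1) ^+ r *: bar_diff b s (emonom r s i k) j l.
Proof.
rewrite /beta -scalerAr; congr (_ *: _).
have := gen_degS s b_gt0; rewrite /bar_diff; case: ifP => s_odd eD.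
  rewrite mulr_sumr; apply: eq_bigr => c _; rewrite -scalerAr emonomY //.
  by have := ltn_ord c; lia.
have <- : q ^+ gen_deg a r *: (emonom r s.+1 i k j l * Y) = emonom r s i k j.+1 l.
  have := @emonomY r s i k j l 1 0; rewrite [(j + 1)%N]addn1 [(l + 0)%N]addn0.
  by rewrite mul1n expr1 !expr0 mulr1; apply; lia.
have <- : emonom r s.+1 i k j l * Y' = emonom r s i k j l.+1.
  have := @emonomY r s i k j l 0 1; rewrite [(l + 1)%N]addn1 [(j + 0)%N]addn0.
  by rewrite mul0n expr1 !expr0 mul1r scale1r; apply; lia.
by rewrite mulrBr -scalerAr.
Qed.

Lemma emonom0 r s : emonom r s 0 0 0 0 = 1.
Proof. by rewrite /emonom /monom !expr0 !mulr1 scale1r. Qed.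

(** The monomial with zero exponents is 1, so the product is the double bar differential evaluated
    at exponents zero. *)
Lemma alpha_alpha r s : alpha r.+1 s * alpha r s = 0.
Proof.
rewrite -[alpha _ _]mul1r -(emonom0 r.+2 s) emonom_alpha -/(rmul (alpha r s) _).
rewrite (raddf_bar_diff a (rmul (alpha r s))).
rewrite (@eq_bar_diff _ _ _ _ _ _ _ (fun i k => emonom_alpha r s i k 0 0)).
apply: bar_diff_diff => i k h; apply: emonom_eq0.
by case/orP: h => ->; rewrite ?orbT.
Qed.

Lemma beta_beta r s : beta r s.+1 * beta r s = 0.
Proof.
rewrite -[beta _ _]mul1r -(emonom0 r s.+2) emonom_beta -scalerAl.
rewrite -/(rmul (beta r s) _) (raddf_bar_diff b (rmul (beta r s))).
rewrite (@eq_bar_diff _ _ _ _ _ _ _ (fun j l => emonom_beta r s 0 0 j l)).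
rewrite -(raddf_bar_diff b ( *:%R ((-1) ^+ r))) bar_diff_diff => [|j l h].
  by change ((-1) ^+ r *: ((-1) ^+ r *: (0 : R)) = 0); rewrite !scaler0.
by apply: emonom_eq0; case/orP: h => ->; rewrite ?orbT.
Qed.

Lemma beta_alpha r s : beta r.+1 s * alpha r s + alpha r s.+1 * beta r s = 0.
Proof.
rewrite -[beta r.+1 s]mul1r -[alpha r s.+1]mul1r -(emonom0 r.+1 s.+1).
rewrite emonom_beta emonom_alpha -scalerAl -!/(rmul _ _).
rewrite (raddf_bar_diff b (rmul (alpha r s))) (raddf_bar_diff a (rmul (beta r s))).
rewrite (@eq_bar_diff _ _ _ _ _ _ _ (fun j l => emonom_alpha r s 0 0 j l)).
rewrite (@eq_bar_diff _ _ _ _ _ _ _ (fun i k => emonom_beta r s i k 0 0)).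
rewrite -(raddf_bar_diff a ( *:%R ((-1) ^+ r))) bar_diffC.
by rewrite exprS mulN1r scaleNr addNr.
Qed.

(** With [monom_eq] this says that the monomials with exponents in range form a basis of [R]: linear
    maps can be prescribed on them and are determined by them. *)
Hypothesis monom_ext : forall g : nat -> nat -> nat -> nat -> R,
  exists G : {linear R -> R}, forall i k j l,
    (i < a)%N -> (k < a)%N -> (j < b)%N -> (l < b)%N ->
    G (monom i k j l) = g i k j l.
Hypothesis monom_eq : forall F G : {linear R -> R},
  (forall i k j l, (i < a)%N -> (k < a)%N -> (j < b)%N -> (l < b)%N ->
    F (monom i k j l) = G (monom i k j l)) -> F =1 G.

(** Asking [g] to vanish out of range, as [emonom] does, makes the conclusion hold for all
    exponents, so it can be used under the shifts in [bar_diff] without side conditions. *)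
Lemma emonom_ext r s (g : nat -> nat -> nat -> nat -> R) :
  (forall i k j l, [|| a <= i, a <= k, b <= j | b <= l]%N -> g i k j l = 0) ->
  exists G : {linear R -> R}, forall i k j l, G (emonom r s i k j l) = g i k j l.
Proof.
move=> g0.
have [G GE] := monom_ext (fun i k j l =>
  (q ^+ (j * gen_deg a r + k * gen_deg b s + j * k))^-1 *: g i k j l).
exists G => i k j l.
have [h|] := boolP [|| a <= i, a <= k, b <= j | b <= l]%N.
  by rewrite emonom_eq0 // g0 // linear0.
rewrite !negb_or -!ltnNge => /and4P[ia ka jb lb].
by rewrite /emonom linearZ /= GE // scalerA mulfV ?scale1r // expf_neq0.
Qed.

Lemma emonom_eq r s (F G : {linear R -> R}) :
  (forall i k j l, (i < a)%N -> (k < a)%N -> (j < b)%N -> (l < b)%N ->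
    F (emonom r s i k j l) = G (emonom r s i k j l)) -> F =1 G.
Proof.
move=> FG; apply: monom_eq => i k j l ia ka jb lb.
have := FG i k j l ia ka jb lb; rewrite /emonom !linearZ /=.
by apply: scalerI; rewrite expf_neq0.
Qed.

Lemma bar_htpy_eq0 (U : zmodType) n r (phi : nat -> nat -> U) i k :
  (n <= i)%N || (n <= k)%N -> (forall i k, (n <= k)%N -> phi i k = 0) ->
  bar_htpy n r phi i k = 0.
Proof.
rewrite /bar_htpy; case: ltnP => //= ia nk phi0.
case: ifP => _; first by case: ifP => // _; rewrite phi0.
by rewrite big1 // => c _; rewrite phi0 // (leq_trans nk) ?leq_addl.
Qed.

Lemma bar_htpy_eq00 (U : zmodType) n r (phi : nat -> nat -> U) i k :
  (forall i k, phi i k = 0) -> bar_htpy n r phi i k = 0.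
Proof.
by move=> phi0; rewrite /bar_htpy !phi0 big1 // !if_same.
Qed.

Local Notation dx := (fun r s => rmul (alpha r s) : {linear R^o -> R^o}).
Local Notation dy := (fun r s => rmul (beta r s) : {linear R^o -> R^o}).
Local Notation tot n := (tot_obj (R^o : lmodType R) n).
Local Notation rm x := (x \o* idfun : {linear R -> R}).

(** [hx], [hy] and [e] are prescribed on [emonom] by the one-variable formulas, and the identities
    of the tensor product homotopy are checked on that basis. [Pi] pushes all powers to the right
    and is the only remainder, in degree 0. *)
Lemma emonom_tot_exact (Pi : {linear R -> R}) :
  (forall i k j l,
    Pi (emonom 0 0 i k j l) = emonom 0 0 0 (i + k) 0 (j + l)) ->
  (forall n (f : tot n.+1), tot_diff dx dy f = 0 ->
     exists f', tot_diff dx dy f' = f) /\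
  (forall f : tot 0, exists f', tot_diff dx dy f' = f - [ffun r => Pi (f r)]).
Proof.
move=> PiE.
have /choice[hx hxE] : forall rs : nat * nat, exists h : {linear R -> R},
    forall i k j l, h (emonom rs.1 rs.2 i k j l)
      = bar_htpy a rs.1 (fun i k => emonom rs.1.+1 rs.2 i k j l) i k.
  move=> rs; apply: emonom_ext => i k j l; rewrite orbA => /orP[h|h].
    by apply: bar_htpy_eq0 => // i' k' ak; rewrite emonom_eq0 // ak orbT.
  by apply: bar_htpy_eq00 => i' k'; rewrite emonom_eq0 // h !orbT.
have /choice[hy hyE] : forall s, exists h : {linear R -> R}, forall i k j l,
    h (emonom 0 s i k j l) = bar_htpy b s (emonom 0 s.+1 i k) j l.
  move=> s; apply: emonom_ext => i k j l; rewrite orbA => /orP[h|h].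
    apply: bar_htpy_eq00 => j' l'; rewrite emonom_eq0 //.
    by case/orP: h => ->; rewrite ?orbT.
  by apply: bar_htpy_eq0 => // j' l' bl; rewrite emonom_eq0 // bl !orbT.
have /choice[e eE] : forall s, exists h : {linear R -> R}, forall i k j l,
    h (emonom 0 s i k j l) = emonom 0 s 0 (i + k) j l.
  move=> s; apply: emonom_ext => i k j l h; apply: emonom_eq0.
  case/or4P: h => h; rewrite ?h ?orbT //.
    by rewrite (leq_trans h (leq_addr _ _)) ?orbT.
  by rewrite (leq_trans h (leq_addl _ _)) ?orbT.
have dxE r s i k j l : (emonom r.+1 s i k j l * alpha r s : R)
    = bar_diff a r (fun i k => emonom r s i k j l) i k by exact: emonom_alpha.
have dyE s i k j l : (emonom 0 s.+1 i k j l * beta 0 s : R)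
    = bar_diff b s (emonom 0 s i k) j l by rewrite emonom_beta expr0 scale1r.
have hx0 s : rm (alpha 0 s) \o hx (0, s) =1 idfun \- e s.
  apply: (emonom_eq (r := 0) (s := s)) => i k j l ia ka jb lb /=.
  rewrite (hxE (0, s)) /= -/(rmul (alpha 0 s) _).
  rewrite (raddf_bar_htpy a (rmul (alpha 0 s))).
  rewrite (@eq_bar_htpy _ _ _ _ _ _ _ (fun i k => dxE 0 s i k j l)).
  by rewrite bar_htpy_diff // eE.
have hxS r s : (rm (alpha r.+1 s) \o hx (r.+1, s)) \+ (hx (r, s) \o rm (alpha r s))
    =1 idfun.
  apply: (emonom_eq (r := r.+1) (s := s)) => i k j l ia ka jb lb /=.
  rewrite (hxE (r.+1, s)) /= -/(rmul (alpha r.+1 s) _).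
  rewrite (raddf_bar_htpy a (rmul (alpha r.+1 s))).
  rewrite (@eq_bar_htpy _ _ _ _ _ _ _ (fun i k => dxE r.+1 s i k j l)).
  rewrite dxE (raddf_bar_diff a (hx (r, s))).
  rewrite (@eq_bar_diff _ _ _ _ _ _ _ (fun i k => hxE (r, s) i k j l)).
  exact: bar_homotopy.
have hxdy r s : (hx (r, s) \o rm (beta r s)) \+ (rm (beta r.+1 s) \o hx (r, s.+1))
    =1 \0.
  apply: (emonom_eq (r := r) (s := s.+1)) => i k j l ia ka jb lb /=.
  rewrite emonom_beta linearZ /= (raddf_bar_diff b (hx (r, s))).
  rewrite (@eq_bar_diff _ _ _ _ _ _ _ (fun j l => hxE (r, s) i k j l)).
  rewrite (hxE (r, s.+1)) /= -/(rmul (beta r.+1 s) _).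
  rewrite (raddf_bar_htpy a (rmul (beta r.+1 s))).
  rewrite (@eq_bar_htpy _ _ _ _ _ _ _ (fun i k => emonom_beta r.+1 s i k j l)).
  rewrite -(raddf_bar_htpy a ( *:%R ((-1) ^+ r.+1))) bar_htpy_diffC.
  (* [hx] raises the column by one, and [beta] has sign (-1)^r in column r, so the two composites
     come with opposite signs. *)
  have signS (x : R) : (-1) ^+ r *: x + (-1 : K) ^+ r.+1 *: x = 0.
    by rewrite exprS mulN1r scaleNr subrr.
  exact: signS.
have edx s : e s \o rm (alpha 0 s) =1 \0.
  apply: (emonom_eq (r := 1) (s := s)) => i k j l ia ka jb lb /=.
  rewrite dxE (raddf_bar_diff a (e s)) /bar_diff /=. by rewrite !eE addnS subrr.
have edy s : e s \o rm (beta 0 s) =1 rm (beta 0 s) \o e s.+1.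
  apply: (emonom_eq (r := 0) (s := s.+1)) => i k j l ia ka jb lb /=.
  rewrite eE !emonom_beta expr0 !scale1r (raddf_bar_diff b (e s)).
  by apply: eq_bar_diff => j' l' /=; rewrite eE.
have hyS s : (rm (beta 0 s.+1) \o hy s.+1) \+ (hy s \o rm (beta 0 s)) =1 idfun.
  apply: (emonom_eq (r := 0) (s := s.+1)) => i k j l ia ka jb lb /=.
  rewrite hyE -/(rmul (beta 0 s.+1) _) (raddf_bar_htpy b (rmul (beta 0 s.+1))).
  rewrite (@eq_bar_htpy _ _ _ _ _ _ _ (fun j l => dyE s.+1 i k j l)).
  rewrite dyE (raddf_bar_diff b (hy s)).
  rewrite (@eq_bar_diff _ _ _ _ _ _ _ (fun j l => hyE s i k j l)).
  exact: bar_homotopy.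
have hy0 : rm (beta 0 0) \o hy 0 \o e 0 =1 e 0 \- Pi.
  apply: (emonom_eq (r := 0) (s := 0)) => i k j l ia ka jb lb /=.
  rewrite eE hyE -/(rmul (beta 0 0) _) (raddf_bar_htpy b (rmul (beta 0 0))).
  rewrite (@eq_bar_htpy _ _ _ _ _ _ _ (fun j l => dyE 0 0 (i + k) j l)).
  by rewrite bar_htpy_diff // PiE.
pose p' s := if s is 0 then Pi : R^o -> R^o else fun=> 0.
pose h n : tot n -> tot n.+1 :=
  @tot_homotopy R R^o (fun r s => hx (r, s)) (fun s => hy s) (fun s => e s) n.
split=> [n f df|f].
  have h0 : h n 0 = 0.
    apply/ffunP=> r; rewrite !ffunE /=; case: (unlift ord0 r) => [r'|] /=.
      rewrite ffunE; exact: linear0.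
    exact: (linear0 (hy n \o e n)).
  (* The zero [h n 0] is added and then read as h applied to the differential of f, to match the
     homotopy identity. *)
  exists (h n.+1 f); rewrite -[LHS]addr0 -h0 -df.
  rewrite (@tot_homotopyS R R^o dx dy (fun r s => hx (r, s)) (fun s => hy s)
    (fun s => e s) (fun _ _ => fun=> 0) p').
  - by apply/ffunP=> r; rewrite !ffunE /p' if_same addr0 subr0.
  - by move=> r s u v; exact: linearD.
  - by move=> s u v; exact: linearD.
  - by move=> s u; rewrite subr0; exact: hx0.
  - by move=> r s u; rewrite subr0; exact: hxS.
  - by move=> r s u; exact: hxdy.
  - by move=> s u; exact: edx.
  - by move=> s u; exact: edy.
  by move=> s u; rewrite subr0; exact: hyS.
exists (h 0%N f).
rewrite (@tot_homotopy0 R R^o dx dy (fun r s => hx (r, s)) (fun s => hy s)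
  (fun s => e s) (fun _ _ => fun=> 0) p').
- by congr (_ - _); apply/ffunP=> r; rewrite !ffunE (ord1 r) eqxx add0r.
- by move=> s u; rewrite subr0; exact: hx0.
by move=> u; exact: hy0.
Qed.

End Differentials.

(** * Homology of a complex retracting onto harmonic elements *)

Section HarmonicHomology.
Context (K : fieldType) (T : nat -> lmodType K).
Context (d : forall n, {linear T n.+1 -> T n}) (n : nat) (I : finType).
Context (S : {set I}) (hm : I -> T n) (cf : I -> {linear T n -> K^o}).
Hypothesis hm_cycle : forall t, t \in S -> hm t \in cycle d n.
Hypothesis cf_hm : forall t t', cf t (hm t') = (t == t')%:R.
Hypothesis cf_d : forall t y, t \in S -> cf t (d n y) = 0.
Hypothesis harmonic_retract : forall z, z \in cycle d n ->
  exists y, d n y = z - \sum_(t in S) cf t z *: hm t.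

Let comb (v : 'rV[K]_#|S|) : T n := \sum_m v 0 m *: hm (enum_val m).

Let comb_linear : linear comb.
Proof.
move=> c u v; rewrite /comb scaler_sumr -big_split /=; apply: eq_bigr => m _.
by rewrite !mxE scalerDl scalerA.
Qed.

Let comb_cycle v : comb v \in cycle d n.
Proof. by apply: rpred_sum => m _; apply/rpredZ/hm_cycle/enum_valP. Qed.

Let cyc v : cycles d n := Cycles (comb_cycle v).

Let cyc_linear : linear cyc.
Proof. by move=> c u v; apply: val_inj; rewrite /= comb_linear. Qed.

Let cls v : homology d n := qpi (@boundary _ _ d n) (cyc v).

Let cls_linear : linear cls.
Proof. by move=> c u v; rewrite /cls cyc_linear linearP. Qed.

HB.instance Definition _ :=
  GRing.isLinear.Build K 'rV[K]_#|S| (homology d n) *:%R cls cls_linear.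

Let coords (z : cycles d n) : 'rV[K]_#|S| :=
  \row_m (cf (enum_val m) (val z) : K).

Let coords_linear : linear coords.
Proof. by move=> c u v; apply/rowP=> m; rewrite !mxE linearP. Qed.

HB.instance Definition _ :=
  GRing.isLinear.Build K (cycles d n) 'rV[K]_#|S| *:%R coords coords_linear.

Let coords_boundary z : boundary (d := d) (n := n) z -> coords z = 0.
Proof.
by case=> y dy; apply/rowP=> m; rewrite !mxE -dy cf_d // enum_valP.
Qed.

(** The coordinates [cf] vanish on boundaries, so they descend to homology; they are dual to the
    classes of [hm], and every cycle is homologous to its harmonic part. *)
Lemma harmonic_dim : has_dim (homology d n) #|S|.
Proof.
exists cls; exists (fun h => coords (qrepr h)) => [v|h].
  rewrite /= /cls (qlift_pi (g := coords) coords_boundary).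
  apply/rowP=> m; rewrite mxE /= /comb linear_sum (bigD1 m) //= linearZ /= cf_hm.
  rewrite eqxx big1 ?addr0 => [|m' m'm]; first by rewrite [_ *: _]mulr1.
  rewrite linearZ /= cf_hm (inj_eq enum_val_inj) eq_sym (negPf m'm).
  by rewrite [_ *: _]mulr0.
rewrite -[RHS]qreprK; apply/esym/eqP; rewrite /= /cls -subr_eq0 -linearB.
apply/eqP/qpi_gen.
have [y dy] := harmonic_retract (valP (qrepr h)); exists y; rewrite dy /=.
congr (_ - _); rewrite /comb big_enum_val /=; apply: eq_bigr => m _.
by rewrite mxE.
Qed.

End HarmonicHomology.

(** * The complex computing Hochschild homology *)

Section Coefficients.
Context (K : fieldType).

(* After applying A (x)_(A^e) -, the r-th differential in one variable raises
   the exponent by [step] and multiplies by [diff_coef], where u is the power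
   of q coming from the degree in the other variable. *)
Definition step n r := if odd r then n.-1 else 1%N.

Definition diff_coef n (u : K) r : K :=
  if odd r then \sum_(c < n) u ^+ (n.-1 - c) else 1 - u.

(** By [stepS] the complex splits into pieces with at most one arrow at each monomial. If
    [step n r <= i] the arrow comes in from e_(r+1); otherwise it goes out to e_(r-1), or is absent
    when r = 0. Harmonic means that its coefficient is zero. *)
Definition harmonic n (u : K) r i : bool :=
  if (step n r <= i)%N then diff_coef n u r == 0
  else if r is r'.+1 then diff_coef n u r' == 0 else true.

(** At u = 1 the coefficients are 0 for even r and n for odd r. The latter joins x^0 on e_(r+1) to
    x^(n-1) on e_r, so in each positive degree a single exponent depends on the characteristic. *)
Lemma harmonic1 n r i : (i < n)%N ->
  harmonic n 1 r i
  = ((r == 0%N) || (i != (if odd r then n.-1 else 0%N)) || (n%:R == 0 :> K)).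
Proof.
move=> ni; have c1 m : diff_coef n 1 m = if odd m then n%:R else 0.
  rewrite /diff_coef; case: ifP => _; last by rewrite subrr.
  by under eq_bigr => c _ do rewrite expr1n; rewrite sumr_const card_ord.
rewrite /harmonic c1 /step; case: r => [|r] /=.
  by case: (0 < i)%N; rewrite ?eqxx.
rewrite c1; case: (odd r) => /=.
  by case: i ni => [|i] //= ni; rewrite eqxx.
have -> : (n.-1 <= i)%N = (i == n.-1) by lia.
by case: (i == n.-1); rewrite ?eqxx.
Qed.

Lemma harmonicF n u r i : (forall m, diff_coef n u m != 0) ->
  (0 < r)%N || (0 < i)%N -> harmonic n u r i = false.
Proof.
move=> nz; rewrite /harmonic; case: ifP => [_ _|]; first exact: negbTE.
case: r => [|r] /=; last by move=> _ _; exact: negbTE.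
by case: i.
Qed.

Lemma stepS n r : (0 < n)%N -> (step n r + step n r.+1)%N = n.
Proof. by rewrite /step /=; case: (odd r) => /=; lia. Qed.

(** For odd r the geometric sum times 1 - q^t is 1 - q^(t n), which is nonzero. *)
Lemma diff_coef_neq0 n (q : K) t r :
  (0 < n)%N -> (0 < t)%N -> (forall m, (0 < m)%N -> q ^+ m != 1) ->
  diff_coef n (q ^+ t) r != 0.
Proof.
move=> n0 t0 qn; rewrite /diff_coef; case: ifP => _; last first.
  by rewrite subr_eq0 eq_sym qn.
apply: contraTneq (qn (t * n)%N _) => [s0|]; last by rewrite muln_gt0 t0.
rewrite negbK exprM -subr_eq0 -[X in _ - X](expr1n _ n) subrXX.
under eq_bigr => c _ do rewrite expr1n mulr1.
by rewrite s0 mulr0.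
Qed.

End Coefficients.

(** * Double complexes with monomial differentials *)

Section GradedTotal.
Context (K : fieldType) (a b : nat) (V : lmodType K).
Context (dx dy : nat -> nat -> {linear V -> V}) (qx qy : nat -> K).
Context (F : nat -> nat -> nat -> V).
Context (Cf : nat -> 'I_a -> 'I_b -> {linear V -> K^o}).
Hypothesis a_gt0 : (0 < a)%N.
Hypothesis b_gt0 : (0 < b)%N.
Hypothesis F_eq0 : forall r i j, (a <= i)%N || (b <= j)%N -> F r i j = 0.
Hypothesis CfF : forall r i j (i' : 'I_a) (j' : 'I_b),
  Cf r i j (F r i' j') = ((i == i') && (j == j'))%:R.
Hypothesis FE : forall r u, u = \sum_i \sum_j Cf r i j u *: F r i j.
Hypothesis qy0 : qy 0 = 1.
Hypothesis dxF : forall r s i j,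
  dx r s (F r.+1 i j) = diff_coef a (qx (j + gen_deg b s)) r *: F r (i + step a r) j.
Hypothesis dyF : forall r s i j,
  dy r s (F r i j)
  = ((-1) ^+ r * diff_coef b (qy (i + gen_deg a r)) s) *: F r i (j + step b s).
Hypothesis qx_coef : forall t r, (0 < t)%N -> diff_coef a (qx t) r != 0.

Definition lin_ext r (g : nat -> nat -> V) (u : V) : V :=
  \sum_(i < a) \sum_(j < b) Cf r i j u *: g i j.

Lemma lin_ext_linear r g : linear (lin_ext r g).
Proof.
move=> c u v; rewrite /lin_ext scaler_sumr -big_split /=; apply: eq_bigr => i _.
rewrite scaler_sumr -big_split /=; apply: eq_bigr => j _.
by rewrite linearP scalerDl scalerA.
Qed.

HB.instance Definition _ r g :=
  GRing.isLinear.Build K V V *:%R (lin_ext r g) (lin_ext_linear r g).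

Lemma lin_extF r g i j :
  lin_ext r g (F r i j) = if (i < a)%N && (j < b)%N then g i j else 0.
Proof.
case: ifP => [/andP[ia jb]|]; last first.
  by move/negbT; rewrite negb_and -!leqNgt => h; rewrite F_eq0 // linear0.
rewrite /lin_ext.
transitivity (\sum_(i' < a) \sum_(j' < b)
    ((i' == Ordinal ia) && (j' == Ordinal jb))%:R *: g i' j').
  apply: eq_bigr => i' _; apply: eq_bigr => j' _; congr (_ *: _).
  exact: (CfF r i' j' (Ordinal ia) (Ordinal jb)).
rewrite (bigD1 (Ordinal ia)) //= (bigD1 (Ordinal jb)) //= !eqxx scale1r.
rewrite [X in _ + X + _]big1 => [|j' /negPf ->]; last by rewrite andbF scale0r.
rewrite [X in _ + X]big1 ?addr0 // => i' /negPf ->.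
by rewrite big1 // => j' _; rewrite scale0r.
Qed.

Lemma lin_eq r (f g : {linear V -> V}) :
  (forall i j, (i < a)%N -> (j < b)%N -> f (F r i j) = g (F r i j)) -> f =1 g.
Proof.
move=> fg u; rewrite (FE r u) !linear_sum; apply: eq_bigr => i _.
by rewrite !linear_sum; apply: eq_bigr => j _; rewrite !linearZ fg.
Qed.

(** In the corner r = 0, i = 0 no x-arrow enters or leaves and the y-coefficients are taken at u =
    [qy 0] = 1. Everywhere else the x-direction alone decides. *)
Definition is_harmonic r s i j : bool :=
  if (r == 0%N) && (i == 0%N) then harmonic b (1 : K) s j
  else harmonic a (qx (j + gen_deg b s)) r i.

(* Inverting the differential where it is nonzero; elsewhere 0^-1 = 0 makes the
   homotopies vanish, which leaves the harmonic monomials. *)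
Let hx r s := lin_ext r (fun i j =>
  if (step a r <= i)%N
  then (diff_coef a (qx (j + gen_deg b s)) r)^-1 *: F r.+1 (i - step a r) j
  else 0).
Let hy s := lin_ext 0 (fun i j =>
  if (step b s <= j)%N
  then (diff_coef b (qy i) s)^-1 *: F 0 i (j - step b s)
  else 0).
Let e (s : nat) := lin_ext 0 (fun i j => if i == 0%N then F 0 0 j else 0).
Let p r s := lin_ext r (fun i j =>
  if (r == 0%N) && (i == 0%N) then 0
  else (harmonic a (qx (j + gen_deg b s)) r i)%:R *: F r i j).
Let p' s := lin_ext 0 (fun i j =>
  if i == 0%N then (harmonic b (1 : K) s j)%:R *: F 0 0 j else 0).

Let hx0 s : dx 0 s \o hx 0 s =1 idfun \- p 0 s \- e s.
Proof.
apply: (lin_eq (r := 0)) => i j ia jb /=.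
rewrite !lin_extF ia jb /=; case: i ia => [|i] ia /=.
  by rewrite linear0 subr0 subrr.
rewrite linearZ /= dxF subn1 addn1 scalerA subr0 /harmonic /=.
case: eqP => [->|/eqP nz].
  by rewrite mulr0 scale0r scale1r subrr.
by rewrite mulVf // scale1r scale0r subr0.
Qed.

Let hxS r s : (dx r.+1 s \o hx r.+1 s) \+ (hx r s \o dx r s) =1 idfun \- p r.+1 s.
Proof.
apply: (lin_eq (r := r.+1)) => i j ia jb /=.
rewrite dxF linearZ /= !lin_extF ia jb /= andbT leq_addl addnK /harmonic.
have := stepS r a_gt0 => sE.
case: (leqP (step a r.+1) i) => h.
  rewrite (_ : (i + step a r < a)%N = false) ?scaler0 ?addr0; last by lia.
  rewrite linearZ /= dxF subnK // scalerA.
  case: eqP => [->|/eqP nz]; first by rewrite mulr0 scale0r scale1r subrr.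
  by rewrite mulVf // scale1r scale0r subr0.
rewrite (_ : (i + step a r < a)%N); last by lia.
rewrite linear0 add0r scalerA.
case: eqP => [->|/eqP nz]; first by rewrite mul0r scale0r scale1r subrr.
by rewrite mulfV // scale1r scale0r subr0.
Qed.

Let gen_deg_step n r : (0 < n)%N -> gen_deg n r.+1 = (gen_deg n r + step n r)%N.
Proof. exact: gen_degS. Qed.

(** Each coefficient depends only on the total degree in the other variable. [hx] preserves i +
    gen_deg a r and [dy] preserves j + gen_deg b s, so the coefficients agree and the sign of [dy]
    cancels the two terms. *)
Let hxdy r s : (hx r s \o dy r s) \+ (dy r.+1 s \o hx r s.+1) =1 \0.
Proof.
apply: (lin_eq (r := r)) => i j ia jb /=.
rewrite dyF linearZ /= !lin_extF ia jb /=.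
case: (leqP (step a r) i) => h; last by rewrite linear0 if_same scaler0 addr0.
rewrite linearZ /= dyF !gen_deg_step //.
have -> : (i - step a r + (gen_deg a r + step a r) = i + gen_deg a r)%N by lia.
have -> : (j + step b s + gen_deg b s = j + (gen_deg b s + step b s))%N by lia.
case: ltnP => jb'; last first.
  by rewrite scaler0 add0r F_eq0 ?scaler0 // jb' orbT.
by rewrite !scalerA -scalerDl exprS mulN1r !mulNr mulrN [X in X - _]mulrC subrr scale0r.
Qed.

Let edx s : e s \o dx 0 s =1 \0.
Proof.
apply: (lin_eq (r := 1)) => i j ia jb /=.
by rewrite dxF linearZ /= lin_extF addn1 /= if_same scaler0.
Qed.

Let edy s : e s \o dy 0 s =1 dy 0 s \o e s.+1.
Proof.
apply: (lin_eq (r := 0)) => i j ia jb /=.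
rewrite dyF linearZ /= !lin_extF ia jb /=.
case: eqP => [->|_]; last by rewrite if_same scaler0 linear0.
rewrite dyF; case: ltnP => // h.
by rewrite F_eq0 ?scaler0 // h orbT.
Qed.

Let hyS s : (dy 0 s.+1 \o hy s.+1 \o e s.+1) \+ (hy s \o dy 0 s \o e s.+1)
  =1 e s.+1 \- p' s.+1.
Proof.
apply: (lin_eq (r := 0)) => i j ia jb /=.
rewrite !lin_extF ia jb /=.
case: eqP => [_|_]; last by rewrite !linear0 !addr0.
rewrite dyF linearZ /= !lin_extF a_gt0 jb /= leq_addl addnK /harmonic.
rewrite /gen_deg /= !muln0 !addn0 qy0 expr0 mul1r.
have := stepS s b_gt0 => sE.
case: (leqP (step b s.+1) j) => h.
  rewrite (_ : (j + step b s < b)%N = false) ?scaler0 ?addr0; last by lia.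
  rewrite linearZ /= dyF subnK // /gen_deg /= muln0 !addn0 qy0 expr0 mul1r scalerA.
  case: eqP => [->|/eqP nz]; first by rewrite mulr0 scale0r scale1r subrr.
  by rewrite mulVf // scale1r scale0r subr0.
rewrite (_ : (j + step b s < b)%N); last by lia.
rewrite linear0 add0r scalerA.
case: eqP => [->|/eqP nz]; first by rewrite mul0r scale0r scale1r subrr.
by rewrite mulfV // scale1r scale0r subr0.
Qed.

Let hy0 : dy 0 0 \o hy 0 \o e 0 =1 e 0 \- p' 0.
Proof.
apply: (lin_eq (r := 0)) => i j ia jb /=.
rewrite !lin_extF ia jb /=.
case: eqP => [_|_]; last by rewrite !linear0 addr0.
rewrite lin_extF a_gt0 jb /= qy0 /harmonic /= /diff_coef /= subrr eqxx.
by case: ifP => _; rewrite ?invr0 ?scale0r linear0 scale1r subrr.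
Qed.

Lemma cf_dx (r s : nat) (i : 'I_a) (j : 'I_b) u :
  is_harmonic r s i j -> Cf r i j (dx r s u) = 0.
Proof.
move=> har.
suff z : Cf r i j \o dx r s =1 (\0%R : {linear V -> K^o}) by exact: z u.
move=> v; rewrite (FE r.+1 v) [LHS]linear_sum big1 // => i' _.
rewrite [LHS]linear_sum big1 // => j' _; rewrite [LHS]linearZ /= dxF linearZ /=.
have [ia|ia] := ltnP (i' + step a r) a; last by rewrite F_eq0 ?ia // linear0 !scaler0.
rewrite (CfF r i j (Ordinal ia) j').
have [/eqP/(congr1 val)/= ii|] := boolP (i == _); last by rewrite !scaler0.
have [/eqP jj|] := boolP (j == j'); last by rewrite !scaler0.
suff -> : diff_coef a (qx (j' + gen_deg b s)) r = 0 by rewrite scale0r scaler0.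
move: har; rewrite /is_harmonic -jj /harmonic {1 2}ii leq_addl.
case: r {u v} ii ia => [|r] ii ia /=; last by move/eqP.
by rewrite /step /= addn1 /= => /eqP.
Qed.

(** Outside the corner r = 0, i = 0, a monomial hit by [dy] has positive y-degree, and there
    [qx_coef] leaves nothing harmonic. *)
Lemma cf_dy (r s : nat) (i : 'I_a) (j : 'I_b) u :
  is_harmonic r s i j -> Cf r i j (dy r s u) = 0.
Proof.
move=> har; rewrite (FE r u) !linear_sum big1 // => i' _.
rewrite !linear_sum big1 // => j' _; rewrite !linearZ /= dyF linearZ /=.
have [jb|jb] := ltnP (j' + step b s) b; last first.
  by rewrite F_eq0 ?jb ?orbT // linear0 !scaler0.
rewrite (CfF r i j i' (Ordinal jb)).
have [/eqP ii|] := boolP (i == i'); last by rewrite !scaler0.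
have [/eqP/(congr1 val)/= jj|] := boolP (j == _); last by rewrite !scaler0.
suff -> : diff_coef b (qy (i' + gen_deg a r)) s = 0.
  by rewrite mulr0 scale0r scaler0.
move: har; rewrite /is_harmonic -ii; case: ifP => [/andP[/eqP-> /eqP->]|ri0].
  by rewrite /harmonic jj leq_addl /gen_deg /= muln0 qy0 => /eqP.
rewrite harmonicF //.
  move=> m; apply: qx_coef; rewrite jj /step /gen_deg.
  by case: (odd s) => /=; lia.
by move: ri0; case: (r) => [|r'] //; case: (nat_of_ord i).
Qed.

Local Notation tot n := (tot_obj V n).
Local Notation I n := ('I_n.+1 * 'I_a * 'I_b)%type.

Definition harmonic_set n : {set I n} :=
  [set t : I n | is_harmonic t.1.1 (n - t.1.1) t.1.2 t.2].

Let hm n (t : I n) : tot n :=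
  [ffun r => if r == t.1.1 then F r t.1.2 t.2 else 0].

Let cf n (t : I n) (f : tot n) : K^o := Cf t.1.1 t.1.2 t.2 (f t.1.1).

Let cf_linear n t : linear (@cf n t).
Proof. by move=> c u v; rewrite /cf !ffunE linearP. Qed.

HB.instance Definition _ n t :=
  GRing.isLinear.Build K (tot n) K^o *:%R (@cf n t) (@cf_linear n t).

(** An arrow leaving a harmonic monomial along x either has coefficient zero or leads to an exponent
    out of range. Along y the same holds in the corner; elsewhere the y-degree would be positive,
    excluding harmonicity. *)
Let hm_cycle n t : t \in harmonic_set n ->
  hm t \in @Defs.cycle _ _ (fun n => @tot_diff K V dx dy n) n.
Proof.
case: n t => // n [[r i] j]; rewrite !inE /= => har; rewrite unfold_in /=.
apply/eqP/ffunP=> r'; rewrite !ffunE /=.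
set u := dx _ _ _; set v := dy _ _ _.
have -> : u = 0.
  rewrite /u; case: eqP => [rE|_]; last exact: linear0.
  move: har; rewrite /is_harmonic -rE /= /bump leq0n add1n subSS dxF.
  rewrite /harmonic; have := stepS r' a_gt0 => sE.
  case: leqP => [h _|_ /eqP ->]; last by rewrite scale0r.
  by rewrite F_eq0 ?scaler0 //; apply/orP; left; lia.
have -> : v = 0; last by rewrite addr0.
rewrite /v; case: eqP => [rE|_]; last exact: linear0.
move: har; rewrite /is_harmonic -rE /= subSn ?leq_ord // dyF.
case: ifP => [/andP[/eqP-> /eqP->]|ri0]; last first.
  rewrite harmonicF //; last first.
    by move: ri0; case: (nat_of_ord r') => //; case: (nat_of_ord i).
  by move=> m; apply: qx_coef; rewrite gen_deg_step // /step /gen_deg; case: (odd _);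
    rewrite ?addn1 ?addnS.
rewrite subn0 /gen_deg /= muln0 qy0 expr0 mul1r /harmonic.
have := stepS n b_gt0 => sE.
case: leqP => [h _|_ /eqP ->]; last by rewrite scale0r.
by rewrite F_eq0 ?scaler0 //; apply/orP; right; lia.
Qed.

Let tot_projE n (z : tot n) :
  tot_proj p p' z = \sum_(t in harmonic_set n) cf t z *: hm t.
Proof.
apply/ffunP=> r; rewrite ffunE sum_ffunE.
under eq_bigr => t _ do rewrite !ffunE.
rewrite big_mkcond /=.
transitivity (\sum_r' \sum_i \sum_j
    if (r', i, j) \in harmonic_set n
    then cf (r', i, j) z *: (if r == r' then F r i j else 0) else 0); last first.
  rewrite pair_bigA pair_bigA /=; apply: eq_bigr => -[[r' i] j] _ /=.
  by [].
rewrite [RHS](bigD1 r) //= [X in _ = _ + X]big1 ?[in RHS]addr0 => [|r' r'r]; last first.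
  rewrite big1 // => i _; rewrite big1 // => j _.
  by rewrite eq_sym (negPf r'r) scaler0 if_same.
transitivity (\sum_(i < a) \sum_(j < b)
   Cf r i j (z r) *: ((is_harmonic r (n - r) i j)%:R *: F r i j)); last first.
  apply: eq_bigr => i _; apply: eq_bigr => j _; rewrite inE /= eqxx.
  by case: is_harmonic; rewrite ?scale1r // scale0r scaler0.
rewrite /p /p' /lin_ext /is_harmonic.
case: (altP (r =P ord0)) => [->|r0].
  rewrite subn0 /= -big_split /=; apply: eq_bigr => i _.
  rewrite -big_split /=; apply: eq_bigr => j _; rewrite -scalerDr; congr (_ *: _).
  by case: eqP => [->|_]; rewrite ?add0r ?addr0.
rewrite addr0; apply: eq_bigr => i _; apply: eq_bigr => j _; congr (_ *: _).
by rewrite -[_ == 0%N]/(r == ord0) (negPf r0).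
Qed.

Lemma graded_tot_dim n :
  has_dim (homology (fun n => @tot_diff K V dx dy n) n) #|harmonic_set n|.
Proof.
apply: (harmonic_dim (hm := @hm n) (cf := fun t => @cf n t)).
- exact: hm_cycle.
- move=> [[r i] j] [[r' i'] j']; rewrite /= /cf /hm ffunE /=.
  rewrite !xpair_eqE; case: eqP => [->|_] /=; first exact: CfF.
  by rewrite linear0.
- move=> [[r i] j] y; rewrite inE /= /cf ffunE linearD /= => har.
  by rewrite cf_dx // cf_dy // addr0.
move=> z zc; rewrite -tot_projE.
pose h m : tot m -> tot m.+1 := @tot_homotopy K V (fun r s => hx r s) (fun s => hy s)
  (fun s => e s) m.
exists (h n z).
case: n z zc => [|n] z zc.
  apply: tot_homotopy0 => [s u|u]; first exact: hx0.
  exact: hy0.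
have h0 : h n 0 = 0.
  apply/ffunP=> r; rewrite !ffunE /=; case: (unlift ord0 r) => [r'|] /=.
    by rewrite ffunE; exact: linear0.
  exact: (linear0 (hy n \o e n)).
have dz : tot_diff dx dy z = 0 by move: zc; rewrite unfold_in => /eqP.
rewrite -[LHS]addr0 -h0 -[X in _ + h n X]dz.
apply: tot_homotopyS.
- by move=> r s u v; exact: linearD.
- by move=> s u v; exact: linearD.
- exact: hx0.
- exact: hxS.
- exact: hxdy.
- exact: edx.
- exact: edy.
exact: hyS.
Qed.

End GradedTotal.

(** In characteristic zero [characteristic K] is 0, which divides only 0, so the equivalence covers
    that case as well. *)
Lemma characteristicP (K : fieldType) n :
  (characteristic K %| n)%N = (n%:R == 0 :> K).
Proof.
rewrite /characteristic; case: classical_sets.xgetP => [p _ /= pK|noK].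
  exact: dvdn_pcharf.
have /pcharf0P -> : [pchar K] =i pred0 by move=> p; apply/negbTE/negP/noK.
exact: dvd0n.
Qed.

(** * Counting harmonic monomials *)

Lemma card_harmonic1 (K : fieldType) a n : (0 < a)%N -> (0 < n)%N ->
  #|[set i : 'I_a | harmonic a (1 : K) n i]| = (a - 1 + (a%:R == 0%R :> K))%N.
Proof.
move=> a0 n0; have xa : ((if odd n then a.-1 else 0) < a)%N by case: odd; lia.
have harE (i : 'I_a) : (i \in [set i : 'I_a | harmonic a (1 : K) n i])
    = (i != Ordinal xa) || (a%:R == 0%R :> K).
  by rewrite inE harmonic1 // (negPf (lt0n_neq0 n0)).
case: (a%:R == 0%R :> K) harE => harE.
  rewrite subnK // -[RHS]card_ord; apply: eq_card => i.
  by rewrite harE orbT.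
rewrite addn0 subn1 -[in RHS](card_ord a) -(cardC1 (Ordinal xa)).
by apply: eq_card => i; rewrite harE orbF.
Qed.

(** Either the y-degree is zero, so r = n and j = 0, or the x-degree is zero, so r = 0 and i = 0.
    The two families meet only in the monomial 1 for n = 0; [S1] omits it and leaves it to [S2]. *)
Lemma card_harmonic_set (K : fieldType) a b (qx : nat -> K) n :
  (0 < a)%N -> (0 < b)%N -> qx 0%N = 1 ->
  (forall t r, (0 < t)%N -> diff_coef a (qx t) r != 0) ->
  #|harmonic_set a b qx n|
  = if n == 0%N then (a + b - 1)%N
    else (a - 1 + (a%:R == 0%R :> K) + (b - 1 + (b%:R == 0%R :> K)))%N.
Proof.
move=> a0 b0 qx0 qx_coef; pose i0 := Ordinal a0; pose j0 := Ordinal b0.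
pose S1 := [set i : 'I_a | harmonic a (1 : K) n i && ((0 < n) || (0 < i))%N].
pose S2 := [set j : 'I_b | harmonic b (1 : K) n j].
pose f1 (i : 'I_a) := (ord_max : 'I_n.+1, i, j0).
pose f2 (j : 'I_b) := (ord0 : 'I_n.+1, i0, j).
have -> : harmonic_set a b qx n = (f1 @: S1) :|: (f2 @: S2).
  apply/setP=> -[[r i] j]; rewrite !inE /= /is_harmonic; apply/idP/orP.
    case: ifP => [/andP[/eqP r0 /eqP i0'] hj|ri0 hi].
      right; apply/imsetP; exists j; first by rewrite inE; rewrite r0 subn0 in hj.
      by congr (_, _, _); apply: val_inj.
    have ri : ((0 < r) || (0 < i))%N.
      by move: ri0; case: (nat_of_ord r) => //; case: (nat_of_ord i).
    have [t0|t0] := posnP (j + gen_deg b (n - r)); last first.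
      by rewrite harmonicF // in hi => m; exact: qx_coef.
    have [jE rE] : j = j0 /\ r = ord_max.
      move: t0 => /eqP; rewrite addn_eq0 => /andP[/eqP je /eqP ge].
      split; apply: val_inj => //=; apply/eqP; rewrite eqn_leq leq_ord /=.
      rewrite -subn_eq0; move: ge; rewrite /gen_deg; case: (n - r)%N => // m /eqP.
      by case: m => [|m] //; rewrite addn_eq0 muln_eq0 (negPf (lt0n_neq0 b0)) /=.
    left; apply/imsetP; exists i; last by rewrite jE rE.
    by move: hi ri; rewrite t0 qx0 rE inE => ->.
  case=> /imsetP[x]; rewrite inE => hx [-> -> ->] /=; last by rewrite subn0.
  case/andP: hx => hx nx; rewrite subnn /gen_deg muln0 !addn0 qx0.
  by case: ifP => // /andP[/eqP n0 /eqP x0]; rewrite n0 x0 in nx.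
rewrite cardsU (_ : _ :&: _ = finset.set0) ?cards0 ?subn0; last first.
  apply/setP=> t; rewrite !inE; apply/negP=> /andP[/imsetP[i]].
  rewrite inE => /andP[_ ni] -> /imsetP[j _ [n0 ii _]].
  by rewrite ii /= n0 in ni.
rewrite !card_imset; last 2 first.
- by move=> j j' [].
- by move=> i i' [].
case: eqP => [n0|/eqP]; last first.
  rewrite -lt0n => n0.
  rewrite -(card_harmonic1 K a0 n0) -(card_harmonic1 K b0 n0); congr (_ + _)%N.
  by apply: eq_card => i; rewrite !inE n0 andbT.
have -> : #|S2| = b.
  by rewrite -[RHS]card_ord; apply: eq_card => j; rewrite !inE n0 harmonic1.
have -> : #|S1| = (a - 1)%N.
  rewrite subn1 -[in RHS](card_ord a) -(cardC1 i0); apply: eq_card => i.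
  by rewrite !inE n0 harmonic1 //= lt0n.
lia.
Qed.

(** * Hochschild homology of the quantum complete intersection *)

Section QuantumAlgebra.
Context (K : fieldType) (A : falgType K) (a b : nat) (q : K) (x y : A).
Hypothesis a_gt0 : (0 < a)%N.
Hypothesis b_gt0 : (0 < b)%N.
Hypothesis q_neq0 : q != 0.
Hypothesis q_free : forall m, (0 < m)%N -> q ^+ m != 1.
Hypothesis xa : x ^+ a = 0.
Hypothesis yb : y ^+ b = 0.
Hypothesis xy : x * y = q *: (y * x).
Context (C : 'I_a -> 'I_b -> {linear A -> K^o}).
Hypothesis Cxy : forall i j i' j', C i j (x ^+ (i' : 'I_a) * y ^+ (j' : 'I_b))
  = ((i == i') && (j == j'))%:R.
Hypothesis CE : forall t, t = \sum_i \sum_j C i j t *: (x ^+ i * y ^+ j).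

Local Notation R := (envalg A).

Definition pure (u v : A) : R := @otimes K A A^c u v.

Lemma pureM u v u' v' : pure u v * pure u' v' = pure (u * u') (v' * v).
Proof. exact: talg_mulE. Qed.

Lemma pureXl u n : pure u 1 ^+ n = pure (u ^+ n) 1.
Proof.
elim: n => [|n IHn]; first by rewrite !expr0.
by rewrite !exprS IHn pureM mulr1.
Qed.

Lemma pureXr u n : pure 1 u ^+ n = pure 1 (u ^+ n).
Proof.
elim: n => [|n IHn]; first by rewrite !expr0.
by rewrite !exprS IHn pureM mulr1 -exprSr -exprS.
Qed.

Lemma pureZl c u v : pure (c *: u) v = c *: pure u v.
Proof. exact: otimesZl. Qed.

Lemma pureZr c u v : pure u (c *: v) = c *: pure u v.
Proof. exact: (@otimesZr K A A^c c u v). Qed.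

Lemma pure_act u v (t : left_env A) : pure u v *: t = u * (t : A) * v :> A.
Proof. exact: env_lactE. Qed.

Lemma pure_ract u v (t : right_env A) :
  ract (pure u v) (t : @restr K R^c (right_env A)) = v * (t : A) * u :> A.
Proof. exact: env_ractE. Qed.

Let X : R := pure x 1.
Let X' : R := pure 1 x.
Let Y : R := pure y 1.
Let Y' : R := pure 1 y.

Let pure_comm u v : GRing.comm (pure u 1) (pure 1 v).
Proof. by rewrite /GRing.comm !pureM !mul1r !mulr1. Qed.

Let XY : X * Y = q *: (Y * X).
Proof. by rewrite !pureM mulr1 xy pureZl. Qed.

Let Y'X' : Y' * X' = q *: (X' * Y').
Proof. by rewrite !pureM mulr1 xy pureZr. Qed.

Let pure0 (u : A) : pure u 0 = 0.
Proof. by have := pureZr 0 u 0; rewrite !scale0r. Qed.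

Let pure0l (u : A) : pure 0 u = 0.
Proof. by have := pureZl 0 0 u; rewrite !scale0r. Qed.

Let Xa : X ^+ a = 0. Proof. by rewrite pureXl xa pure0l. Qed.
Let Yb : Y ^+ b = 0. Proof. by rewrite pureXl yb pure0l. Qed.
Let X'a : X' ^+ a = 0. Proof. by rewrite pureXr xa pure0. Qed.
Let Y'b : Y' ^+ b = 0. Proof. by rewrite pureXr yb pure0. Qed.

Let monomE i k j l :
  monom X Y X' Y' i k j l = pure (x ^+ i * y ^+ j) (x ^+ k * y ^+ l).
Proof. by rewrite /monom !pureXl !pureXr !pureM !mulr1. Qed.

Lemma basis_eq (U : lmodType K) (f g : A -> U) : linear f -> linear g ->
  (forall i j, (i < a)%N -> (j < b)%N -> f (x ^+ i * y ^+ j) = g (x ^+ i * y ^+ j))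
  -> f =1 g.
Proof.
move=> fl gl fg t.
pose fL : {linear A -> U} := HB.pack f (GRing.isLinear.Build K A U *:%R f fl).
pose gL : {linear A -> U} := HB.pack g (GRing.isLinear.Build K A U *:%R g gl).
rewrite -[f]/(fL : A -> U) -[g]/(gL : A -> U) (CE t) !linear_sum.
apply: eq_bigr => i _; rewrite !linear_sum; apply: eq_bigr => j _.
by rewrite !linearZ /= fg.
Qed.

Lemma envalg_monom_eq (F G : {linear R -> R}) :
  (forall i k j l, (i < a)%N -> (k < a)%N -> (j < b)%N -> (l < b)%N ->
    F (monom X Y X' Y' i k j l) = G (monom X Y X' Y' i k j l)) -> F =1 G.
Proof.
move=> FG; elim/tens_ind => [u v|c u v Fu Fv]; last by rewrite !linearP Fu Fv.
have Ol v' (H : {linear R -> R}) : linear (fun u => H (pure u v')).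
  by move=> c t t'; rewrite -linearP -pureZl; congr (H _); exact: otimesDl.
have Or u' (H : {linear R -> R}) : linear (fun v : A => H (pure u' v)).
  by move=> c t t'; rewrite -linearP -pureZr; congr (H _); exact: otimesDr.
apply: (basis_eq (Ol v F) (Ol v G)) => i j ia jb.
apply: (basis_eq (Or _ F) (Or _ G)) => k l ka lb.
by rewrite -monomE; exact: FG.
Qed.

Lemma envalg_monom_ext (g : nat -> nat -> nat -> nat -> R) :
  exists G : {linear R -> R}, forall i k j l,
    (i < a)%N -> (k < a)%N -> (j < b)%N -> (l < b)%N ->
    G (monom X Y X' Y' i k j l) = g i k j l.
Proof.
pose f (u : A) (v : A^c) : R :=
  \sum_i \sum_j C i j u *: \sum_k \sum_l C k l v *: g i k j l.
have fb : bilin f.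
  split=> [v c u u'|u c v v']; rewrite /f scaler_sumr -big_split /=.
    apply: eq_bigr => i _; rewrite scaler_sumr -big_split /=; apply: eq_bigr => j _.
    by rewrite linearP scalerDl scalerA.
  apply: eq_bigr => i _; rewrite scaler_sumr -big_split /=; apply: eq_bigr => j _.
  rewrite [c *: (_ *: _)]scalerA [c * _]mulrC -scalerA -scalerDr; congr (_ *: _).
  rewrite scaler_sumr -big_split /=; apply: eq_bigr => k _.
  rewrite scaler_sumr -big_split /=; apply: eq_bigr => l _.
  rewrite scalerA -scalerDl; congr (_ *: _); exact: (linearP (C k l)).
pose G : {linear R -> R} := HB.pack (tens_lift f)
  (GRing.isLinear.Build K R R *:%R (tens_lift f) (tens_lift_linear fb)).
exists G => i k j l ia ka jb lb; rewrite monomE [LHS](tens_liftE fb).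
have sel (U : lmodType K) (h : nat -> nat -> U) i' j' : (i' < a)%N -> (j' < b)%N ->
    \sum_i \sum_j C i j (x ^+ i' * y ^+ j') *: h i j = h i' j'.
  move=> i'a j'b.
  rewrite (bigD1 (Ordinal i'a)) //= (bigD1 (Ordinal j'b)) //=.
  rewrite (Cxy _ _ (Ordinal i'a) (Ordinal j'b)) !eqxx scale1r.
  rewrite [X in _ + X + _]big1 => [|j'' /negPf jj]; last first.
    by rewrite (Cxy _ _ (Ordinal i'a) (Ordinal j'b)) jj andbF scale0r.
  rewrite [X in _ + X]big1 ?addr0 // => i'' /negPf ii; rewrite big1 // => j'' _.
  by rewrite (Cxy _ _ (Ordinal i'a) (Ordinal j'b)) ii scale0r.
rewrite /f (sel _ (fun i j => \sum_k \sum_l C k l _ *: g i k j l)) //.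
exact: (sel _ (fun k l => g i k j l)).
Qed.

Local Notation al := (alpha a b q X X').
Local Notation be := (beta a b q Y Y').

(** The multiplication map of A, written as the action on 1 so that linearity over A^e is
    immediate. *)
Definition aug (u : R^o) : left_env A := (u : R) *: ((1 : A) : left_env A).

Lemma aug_linear : linear aug.
Proof. by move=> c u v; rewrite /aug scalerDl; congr (_ + _); exact/esym/scalerA. Qed.

HB.instance Definition _ :=
  GRing.isLinear.Build R R^o (left_env A) *:%R aug aug_linear.

Lemma aug_pure u v : aug (pure u v) = u * v :> A.
Proof. by rewrite /aug [LHS]pure_act mulr1. Qed.

Lemma augM (u v : R) : aug v = 0 -> aug (u * v) = 0.
Proof. by move=> v0; rewrite /aug -[LHS]scalerA [v *: _]v0 scaler0. Qed.

Lemma augZ c (u : R) : aug (c *: u) = c *: (aug u : A) :> A.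
Proof.
have aL : linear (fun u : R => aug u : A) by move=> d v w; exact: env_lact_linear.
have a0 : aug 0 = 0 by exact: linear0.
by have := aL c u 0; rewrite a0 !addr0.
Qed.

Let aug_al u : aug (u * al 0 0) = 0.
Proof.
apply: augM; rewrite /alpha /= /gen_deg muln0 addn0 expr0 scale1r.
by rewrite linearB /= !aug_pure mul1r mulr1 subrr.
Qed.

Let aug_be u : aug (u * be 0 0) = 0.
Proof.
apply: augM; rewrite /beta /= /gen_deg muln0 addn0 !expr0 !scale1r.
by rewrite linearB /= !aug_pure mul1r mulr1 subrr.
Qed.

Let aug_surj t : exists u, aug u = t.
Proof. by exists (pure t 1); rewrite aug_pure mulr1. Qed.

(** Since it factors through [aug], this remainder vanishes on the kernel of the augmentation, which
    yields exactness in degree 0. *)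
Let Pi (u : R) : R := pure 1 (aug u : A).

Let Pi_linear : linear Pi.
Proof.
move=> c u v; rewrite /Pi -pureZr -augZ.
rewrite [aug _]linearD.
exact: otimesDr.
Qed.

HB.instance Definition _ := GRing.isLinear.Build K R R *:%R Pi Pi_linear.

Let yx j i : y ^+ j * x ^+ i = q^-1 ^+ (j * i) *: (x ^+ i * y ^+ j).
Proof.
rewrite (qcommute_exp i j xy) scalerA mulnC -exprMn mulVf // expr1n.
by rewrite scale1r.
Qed.

(** Multiplying out moves y^j past x^k and costs q^-(j k), which cancels the factor q^(j k) of
    [emonom]. *)
Let PiE i k j l : Pi (emonom a b q X Y X' Y' 0 0 i k j l)
  = emonom a b q X Y X' Y' 0 0 0 (i + k) 0 (j + l).
Proof.
rewrite /emonom !monomE /gen_deg /= !muln0 ?add0n ?mul0n expr0 scale1r linearZ /=.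
rewrite /Pi aug_pure mulr1 -pureZr; congr pure.
rewrite -mulrA [y ^+ j * _]mulrA yx -scalerAl -scalerAr scalerA.
by rewrite -exprMn mulfV // expr1n scale1r -[x ^+ k * _ * _]mulrA -exprD mulrA -exprD.
Qed.

Let exactness := emonom_tot_exact a_gt0 b_gt0 q_neq0 Xa X'a Yb Y'b XY Y'X'
  (@pure_comm x x) (@pure_comm x y) (@pure_comm y x) (@pure_comm y y)
  envalg_monom_ext envalg_monom_eq PiE.

Let al_al : forall r s, al r.+1 s * al r s = 0 :=
  alpha_alpha a_gt0 b_gt0 q_neq0 Xa X'a Yb Y'b XY (@pure_comm x x) (@pure_comm x y).

Let be_be : forall r s, be r s.+1 * be r s = 0 :=
  beta_beta a_gt0 b_gt0 q_neq0 Xa X'a Yb Y'b Y'X' (@pure_comm y x) (@pure_comm y y).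

Let be_al : forall r s, be r.+1 s * al r s + al r s.+1 * be r s = 0 :=
  beta_alpha a_gt0 b_gt0 q_neq0 XY Y'X' (@pure_comm x x) (@pure_comm x y)
    (@pure_comm y x) (@pure_comm y y).

Local Notation totR n := (tot_obj (R^o : lmodType R) n).
Local Notation dR n := (@tot_diff R R^o (fun r s => rmul (al r s) : {linear R^o -> R^o})
  (fun r s => rmul (be r s) : {linear R^o -> R^o}) n).

Let exact0 (f : totR 0) : aug (f ord0) = 0 -> exists f', dR 0 f' = f.
Proof.
move=> f0; have [f' f'E] := exactness.2 f; exists f'.
rewrite f'E [X in f - X](_ : _ = 0) ?subr0 //.
by apply/ffunP=> r; rewrite !ffunE (ord1 r) /= /Pi f0 pure0.
Qed.

Definition qci_resolution : proj_resolution (left_env A) :=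
  free_resolution al_al be_be be_al aug_surj aug_al aug_be exact0 exactness.1.

Local Notation V := (@restr K R^c (right_env A)).

Lemma right_restrZ c (m : V) : c *: m = c *: (m : A) :> A.
Proof.
have rl : linear (fun u : R => ract u m : A) by exact: env_ract_linear.
have r0 : (ract (M := right_env A) 0 m : A) = 0 by exact: (@ract0 K R (right_env A) m).
have := rl c 1 0; rewrite r0 !addr0 => e.
have := ract_scale (M := right_env A) c 1 m.
by rewrite ract1 => <-; rewrite e; congr (_ *: _); exact: (@ract1 K R (right_env A) m).
Qed.

(** The factor is the price of y^j passing e_r, as in [emonom]. With it the coefficients in
    [ract_alpha] and [ract_beta] depend only on the total degree in the other variable. *)
Definition hmonom r i j : V := (q ^+ (j * gen_deg a r) *: (x ^+ i * y ^+ j) : A).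

Definition hcoord r (i : 'I_a) (j : 'I_b) (m : V) : K^o :=
  (q ^+ (j * gen_deg a r))^-1 * C i j (m : A).

Lemma hcoord_linear r i j : linear (hcoord r i j).
Proof.
move=> c u v; rewrite /hcoord.
have -> : (c *: u + v : V) = (c *: (u : A) + (v : A)) :> A.
  by congr (_ + _); exact: right_restrZ.
by rewrite linearP mulrDr; congr (_ + _); rewrite mulrCA.
Qed.

HB.instance Definition _ r i j :=
  GRing.isLinear.Build K V K^o *:%R (hcoord r i j) (hcoord_linear r i j).

Lemma hmonom_eq0 r i j : (a <= i)%N || (b <= j)%N -> hmonom r i j = 0.
Proof.
rewrite /hmonom; case/orP=> h.
  by rewrite -(subnK h) [x ^+ _]exprD xa mulr0 mul0r scaler0.
by rewrite -(subnK h) [y ^+ _]exprD yb !mulr0 scaler0.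
Qed.

Lemma hcoord_hmonom r i j (i' : 'I_a) (j' : 'I_b) :
  hcoord r i j (hmonom r i' j') = ((i == i') && (j == j'))%:R.
Proof.
rewrite /hcoord /hmonom linearZ /= Cxy.
case: eqP => [_|]; last by rewrite /= [_ *: _]mulr0 mulr0.
case: eqP => [->|]; last by rewrite /= [_ *: _]mulr0 mulr0.
by rewrite [_ *: _]mulr1 mulVf // expf_neq0.
Qed.

Lemma hmonomE r (u : V) : u = \sum_i \sum_j hcoord r i j u *: hmonom r i j.
Proof.
rewrite [LHS](CE u); apply: eq_bigr => i _; apply: eq_bigr => j _.
rewrite [RHS]right_restrZ /hmonom scalerA /hcoord mulrAC mulVf ?mul1r //.
exact: expf_neq0.
Qed.

Lemma ract_sum (I : Type) (s : seq I) (f : I -> R) (m : V) :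
  ract (\sum_(i <- s) f i) m = \sum_(i <- s) ract (f i) m.
Proof.
apply: (big_morph (fun u : R => ract u m : V)); last exact: ract0.
by move=> u v; exact: ractD.
Qed.

(** The right action puts x^d on the left, at no cost, and x^c on the right, where it passes y^j.
    The power of q this costs is absorbed by the change of normalisation from r + 1 to r. *)
Lemma hmonomX r s i j c d : (gen_deg a r.+1 = gen_deg a r + c + d)%N ->
  ract (q ^+ (d * gen_deg b s) *: (X ^+ c * X' ^+ d)) (hmonom r.+1 i j)
  = (q ^+ (j + gen_deg b s)) ^+ d *: hmonom r (i + (c + d)) j.
Proof.
move=> e; rewrite ract_scale [LHS]right_restrZ [RHS]right_restrZ.
rewrite pureXl pureXr pureM !mulr1 pure_ract /hmonom.
rewrite -scalerAr -scalerAl !scalerA.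
have -> : x ^+ d * (x ^+ i * y ^+ j) * x ^+ c
    = q^-1 ^+ (j * c) *: (x ^+ (i + (c + d)) * y ^+ j).
  rewrite -!mulrA yx -!scalerAr !mulrA -!exprD; congr (_ *: (x ^+ _ * _)); lia.
rewrite scalerA.
suff -> : q ^+ (d * gen_deg b s) * q ^+ (j * gen_deg a r.+1) * q^-1 ^+ (j * c)
  = q ^+ (j + gen_deg b s) ^+ d * q ^+ (j * gen_deg a r) by [].
rewrite e -exprM -!exprD.
have -> : (d * gen_deg b s + j * (gen_deg a r + c + d)
  = (j + gen_deg b s) * d + j * gen_deg a r + j * c)%N by lia.
by rewrite exprD -mulrA -exprMn mulfV // expr1n mulr1.
Qed.

(** Here y^d arrives on the left and passes x^i, which costs q^-(d i); hence the parameter of the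
    y-direction is q^-1. *)
Lemma hmonomY r s i j c d : (gen_deg b s.+1 = gen_deg b s + c + d)%N ->
  ract (q ^+ (c * gen_deg a r) *: (Y ^+ c * Y' ^+ d)) (hmonom r i j)
  = (q^-1 ^+ (i + gen_deg a r)) ^+ d *: hmonom r i (j + (c + d)).
Proof.
move=> e; rewrite ract_scale [LHS]right_restrZ [RHS]right_restrZ.
rewrite pureXl pureXr pureM !mulr1 pure_ract /hmonom.
rewrite -scalerAr -scalerAl !scalerA.
have -> : y ^+ d * (x ^+ i * y ^+ j) * y ^+ c
    = q^-1 ^+ (d * i) *: (x ^+ i * y ^+ (j + (c + d))).
  rewrite mulrA yx -!scalerAl -!mulrA -!exprD; congr (_ *: (_ * y ^+ _)); lia.
rewrite scalerA.
suff -> : q ^+ (c * gen_deg a r) * q ^+ (j * gen_deg a r) * q^-1 ^+ (d * i)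
  = q^-1 ^+ (i + gen_deg a r) ^+ d * q ^+ ((j + (c + d)) * gen_deg a r) by [].
rewrite -exprM -!exprD.
have -> : ((i + gen_deg a r) * d = d * i + d * gen_deg a r)%N by lia.
have -> : ((j + (c + d)) * gen_deg a r
  = d * gen_deg a r + (c * gen_deg a r + j * gen_deg a r))%N by lia.
rewrite [q^-1 ^+ (_ + _)]exprD [q ^+ (d * _ + _)]exprD mulrC -!mulrA.
by congr (_ * _); rewrite mulrA -exprMn mulVf // expr1n mul1r.
Qed.

Lemma ract_alpha r s i j : ract (al r s) (hmonom r.+1 i j)
  = diff_coef a (q ^+ (j + gen_deg b s)) r *: hmonom r (i + step a r) j.
Proof.
have := gen_degS r a_gt0; rewrite /alpha /diff_coef /step; case: ifP => r_odd e.
  rewrite ract_sum scaler_suml; apply: eq_bigr => c _.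
  have := ltn_ord c => ca; rewrite hmonomX; last by lia.
  by congr (_ *: hmonom _ (_ + _) _); lia.
have h1 := @hmonomX r s i j 1 0; have h2 := @hmonomX r s i j 0 1.
rewrite mul0n !expr0 expr1 mulr1 !scale1r in h1.
rewrite mul1n !expr0 !expr1 mul1r in h2.
rewrite -[- (_ *: X')]scaleN1r ractD ract_scale h1 ?h2; try by lia.
by rewrite scaleN1r scalerBl scale1r.
Qed.

Lemma ract_beta r s i j : ract (be r s) (hmonom r i j)
  = ((-1) ^+ r * diff_coef b (q^-1 ^+ (i + gen_deg a r)) s)
    *: hmonom r i (j + step b s).
Proof.
rewrite /beta ract_scale -scalerA; congr (_ *: _).
have := gen_degS s b_gt0; rewrite /diff_coef /step; case: ifP => s_odd e.
  rewrite ract_sum scaler_suml; apply: eq_bigr => c _.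
  have := ltn_ord c => cb; rewrite (@hmonomY _ s); last by lia.
  by congr (_ *: hmonom _ _ (_ + _)); lia.
have h1 := @hmonomY r s i j 1 0; have h2 := @hmonomY r s i j 0 1.
rewrite mul1n !expr0 expr1 mulr1 !scale1r in h1.
rewrite mul0n !expr0 !expr1 mul1r scale1r in h2.
rewrite -[- Y']scaleN1r ractD [ract (-1 *: _) _]ract_scale h1 ?h2; try by lia.
by rewrite scaleN1r scalerBl scale1r.
Qed.

Lemma qci_hochschild_dim n : hochschild_dim A n
  (if n == 0%N then (a + b - 1)%N
   else (a - 1 + (a%:R == 0%R :> K) + (b - 1 + (b%:R == 0%R :> K)))%N).
Proof.
split; first exact: (inhabits qci_resolution).
move=> P; apply: (tor_resolution (P := qci_resolution)).
have coef t r : (0 < t)%N -> diff_coef a (q ^+ t) r != 0.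
  by move=> t0; exact: diff_coef_neq0.
rewrite -(card_harmonic_set n a_gt0 b_gt0 (expr0 q) coef).
apply: tor_free_resolution.
exact: (graded_tot_dim a_gt0 b_gt0 hmonom_eq0 hcoord_hmonom hmonomE
  (expr0 q^-1) ract_alpha ract_beta coef).
Qed.

End QuantumAlgebra.

Theorem theorem3p1 (k : fieldType) (a b : nat) (q : k)
    (a_ge2 : (2 <= a)%N) (b_ge2 : (2 <= b)%N)
    (q_neq0 : q != 0)
    (q_not_root_of_unity : forall m : nat, (0 < m)%N -> ~~ m.-unity_root q)
    (A : falgType k) (pi : {lrmorphism free_alg2 k -> A})
    (A_def : is_quotient pi (qci_rel q a b)) (n : nat) :
  let p := characteristic k in
  hochschild_dim A n
    (if n == 0 then a + b - 1
     else if (p %| a) && (p %| b) then a + b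
     else if (p %| a) (+) (p %| b) then a + b - 1
     else a + b - 2)%N.
Proof.
move=> p; have a0 : (0 < a)%N by lia.
have b0 : (0 < b)%N by lia.
have q_free m : (0 < m)%N -> q ^+ m != 1.
  by move=> /q_not_root_of_unity; rewrite unity_rootE.
have [C [Cxy CE]] := quotient_basis q_neq0 A_def.
have := qci_hochschild_dim a0 b0 q_neq0 q_free (qci_xa A_def) (qci_yb A_def)
  (qci_xy A_def) Cxy CE n.
rewrite /p !characteristicP.
(* In positive degree the dimension is a + b - 2 plus the number of exponents among a, b that vanish
   in k. *)
by congr (hochschild_dim A n _); case: (n == 0%N) => //;
  case: (a%:R == 0); case: (b%:R == 0) => /=; lia.
Qed.
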